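(* Let $m \geq 2$ be an integer and $A(x) = (1+x^{2m})^{1/(2m)}$. For $k \in \mathbb{Z}$ with $|k|$ sufficiently large, let $h = |k|^{-1}$, let $\tilde u = \tilde u_h \in C_c^\infty(\mathbb{R})$ be the quasimode defined in the context, and let $\phi_0(x,\theta) = e^{ik\theta}\tilde u(x)$. Suppose $\psi$ solves $$\begin{cases} (D_t + \widetilde\Delta)\psi = 0, \\ \psi|_{t=0} = \phi_0. \end{cases}$$ Then for any $\chi \in C_c^\infty(\mathbb{R})$ such that $\chi \equiv 1$ on $\operatorname{supp}\tilde u$, and any constant $A_0 > 0$ sufficiently large, independent of $k$, there exists a constant $C_0 > 0$ independent of $k$ such that $$\int_0^{|k|^{-2/(m+1)}/A_0} \| \langle D_\theta \rangle \chi \psi \|_{L^2}^2 \, dt \geq C_0^{-1} \| \langle D_\theta \rangle^{m/(m+1)} \phi_0 \|_{L^2}^2 .$$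
   Context: Here $D_t = \frac1i\partial_t$, $D_\theta = \frac1i\partial_\theta$, $\langle s\rangle = (1+s^2)^{1/2}$, and $\langle D_\theta\rangle^r$ is the Fourier multiplier in $\theta$. The operator $\widetilde\Delta$ acts on functions on $\mathbb{R}_x\times(\mathbb{R}_\theta/2\pi\mathbb{Z})$ with $L^2$ taken with respect to $dx\,d\theta$, and is given by $$-\widetilde\Delta f = \left(-\partial_x^2 - A^{-2}(x)\partial_\theta^2 + V_1(x)\right) f, \qquad V_1 = \tfrac12 A''A^{-1} - \tfrac14 (A')^2A^{-2}.$$ (It is the conjugate $T\Delta T^{-1}$, $Tu = A^{1/2}u$, of the Laplace–Beltrami operator of $dx^2 + A^2(x)d\theta^2$.) Quasimode: fix constants $\alpha,\beta>0$ independent of $h$ and set $E = (\alpha + i\beta)h^{2m/(m+1)}$. Let $\varpi(x) = \int_0^x (E + m^{-1}y^{2m})^{1/2}\,dy$, where the branch of the square root is chosen to have positive imaginary part, and $u(x) = (\varpi'(x))^{-1/2}e^{i\varpi(x)/h}$. Let $\gamma = h^{1/(m+1)}$, fix $\chi_0 \in C_c^\infty(\mathbb{R})$ with $\chi_0(s) = 1$ for $|s|\leq 1$ and $\operatorname{supp}\chi_0\subset[-2,2]$, and set $\tilde u(x) = \chi_0(x/\gamma)u(x)$ (which may be normalized in $L^2$). *)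

(* Defs.v *)
From HB Require Import structures.
From mathcomp Require Import all_boot all_order all_algebra complex.
From mathcomp Require Import all_classical all_reals all_analysis.

Set Implicit Arguments.
Unset Strict Implicit.
Unset Printing Implicit Defensive.

Import Order.TTheory GRing.Theory Num.Theory.
Import numFieldNormedType.Exports.

Local Open Scope classical_set_scope.
Local Open Scope ring_scope.
Local Open Scope complex_scope.

(* Complex-valued functions of a real variable are differentiated and
   integrated through their real and imaginary parts. *)
Section ComplexCalculus.
Context {R : realType}.
Implicit Types (z : R[i]) (a b : R).

Definition cexp z : R[i] :=
  (expR (complex.Re z))%:C * (cos (complex.Im z) +i* sin (complex.Im z)).

Definition abs2 z : R := complex.Re z ^+ 2 + complex.Im z ^+ 2.

Definition cderive (f : R -> R[i]) (x : R) : R[i] :=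
  derive1 (fun y => complex.Re (f y)) x +i* derive1 (fun y => complex.Im (f y)) x.

Definition cintegral (D : set R) (f : R -> R[i]) : R[i] :=
  (\int[lebesgue_measure]_(x in D) complex.Re (f x))%R
  +i* (\int[lebesgue_measure]_(x in D) complex.Im (f x))%R.

Definition cintegral_from_to a b (f : R -> R[i]) : R[i] :=
  if a <= b then cintegral `[a, b] f else - cintegral `[b, a] f.

(* [sqrtc] is the principal branch; on the open upper half plane it is the
   square root with positive imaginary part. *)
Lemma Im_sqrtc_gt0 z : 0 < complex.Im z -> 0 < complex.Im (sqrtc z).
Proof.
case: z => a b /= b0; rewrite gt_eqF// gtr0_sg// mul1r sqrtr_gt0.
rewrite divr_gt0// subr_gt0 (le_lt_trans (ler_norm a))// -sqrtr_sqr.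
by rewrite ltr_sqrt ?ltrDl ?exprn_gt0// ltr_wpDl ?sqr_ge0 ?exprn_gt0.
Qed.

Definition supp (f : R -> R[i]) : set R := closure [set x | f x != 0].

Definition smooth1 (f : R -> R) : Prop :=
  forall (n : nat) (x : R), derivable (derive1n n f) x 1.

Definition Cc_infty (f : R -> R[i]) : Prop :=
  [/\ smooth1 (fun x => complex.Re (f x)), smooth1 (fun x => complex.Im (f x))
    & compact (supp f)].

End ComplexCalculus.

(* Functions on R_x x (R_theta / 2 pi Z) are functions on R x R that are
   2 pi-periodic in the second variable. *)
Section Cylinder.
Context {R : realType}.
Implicit Types (f g : R * R -> R[i]).

Definition periodic_theta f : Prop :=
  forall x theta : R, f (x, theta + 2 * pi) = f (x, theta).

Definition fundamental_domain : set (R * R) := setT `*` `[0, 2 * pi].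

(* The squared L^2(dx dtheta) norm, possibly infinite. *)
Definition sqnorm f : \bar R :=
  (\int[(@lebesgue_measure R \x @lebesgue_measure R)%E]_(p in fundamental_domain)
     (abs2 (f p))%:E)%E.

Definition L2 f : Prop :=
  [/\ periodic_theta f,
      measurable_fun fundamental_domain (fun p => complex.Re (f p)),
      measurable_fun fundamental_domain (fun p => complex.Im (f p))
    & (sqnorm f < +oo)%E].

Definition pdx (f : R * R -> R) (p : R * R) : R :=
  derive1 (fun x => f (x, p.2)) p.1.
Definition pdtheta (f : R * R -> R) (p : R * R) : R :=
  derive1 (fun theta => f (p.1, theta)) p.2.

Fixpoint Cn (n : nat) (f : R * R -> R) : Prop :=
  continuous f /\
  if n is n'.+1 then
    [/\ forall p : R * R, derivable (fun x => f (x, p.2)) p.1 1,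
        forall p : R * R, derivable (fun theta => f (p.1, theta)) p.2 1,
        Cn n' (pdx f) & Cn n' (pdtheta f)]
  else True.

Definition Cc_infty_cyl f : Prop :=
  [/\ periodic_theta f,
      forall n, Cn n (fun p => complex.Re (f p)),
      forall n, Cn n (fun p => complex.Im (f p))
    & exists M : R, forall p : R * R, M < `|p.1| -> f p = 0].

Definition cpdx f : R * R -> R[i] := fun p =>
  pdx (fun q => complex.Re (f q)) p +i* pdx (fun q => complex.Im (f q)) p.
Definition cpdtheta f : R * R -> R[i] := fun p =>
  pdtheta (fun q => complex.Re (f q)) p
  +i* pdtheta (fun q => complex.Im (f q)) p.

Definition fourier_coef f (n : int) (x : R) : R[i] :=
  ((2 * pi)^-1)%:C *
  cintegral `[0, 2 * pi] (fun theta => cexp (0 +i* - (n%:~R * theta)) * f (x, theta)).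

Definition jap (s : R) : R := Num.sqrt (1 + s ^+ 2).

(* g = <D_theta>^r f, for f in the L^2 domain of the Fourier multiplier. *)
Definition is_japD (r : R) f g : Prop :=
  L2 g /\
  forall n : int,
    {ae (@lebesgue_measure R), forall x : R,
      fourier_coef g n x = ((jap n%:~R) `^ r)%:C * fourier_coef f n x}.

(* || <D_theta>^r f ||_{L^2}^2.  As <D_theta>^r f is unique up to null sets,
   the infimum is over a single value if f is in the domain of <D_theta>^r,
   and is +oo otherwise. *)
Definition japD_sqnorm (r : R) f : \bar R :=
  ereal_inf [set sqnorm g | g in [set g | is_japD r f g]].

End Cylinder.

Section Evolution.
Context {R : realType}.
Variable m : nat.

Definition Afun (x : R) : R := (1 + x ^+ (2 * m)) `^ ((2 * m)%:R^-1).

Definition V1 (x : R) : R :=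
  2^-1 * derive1n 2 Afun x * (Afun x)^-1
  - 4^-1 * (derive1 Afun x) ^+ 2 * (Afun x) ^- 2.

(* The differential expression Delta-tilde. *)
Definition lap (f : R * R -> R[i]) : R * R -> R[i] := fun p =>
  - (- cpdx (cpdx f) p
     - ((Afun p.1) ^- 2)%:C * cpdtheta (cpdtheta f) p
     + (V1 p.1)%:C * f p).

(* f is in the domain of the operator Delta-tilde on L^2 and is mapped to g.
   The operator is the self-adjoint realization: the expression [lap] is
   essentially self-adjoint on C_c^infty (the underlying surface is complete
   and V1 is bounded), and we take its closure. *)
Definition lap_graph (f g : R * R -> R[i]) : Prop :=
  [/\ L2 f, L2 g &
    exists u : nat -> R * R -> R[i],
      [/\ forall j, Cc_infty_cyl (u j),
          sqnorm (fun p => u j p - f p) @[j --> \oo] --> 0%E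
        & sqnorm (fun p => lap (u j) p - g p) @[j --> \oo] --> 0%E]].

Definition L2_derivative (psi : R -> R * R -> R[i]) (t : R)
    (v : R * R -> R[i]) : Prop :=
  L2 v /\
  sqnorm (fun p => (s^-1)%:C * (psi (t + s) p - psi t p) - v p)
    @[s --> 0^'] --> 0%E.

(* psi in C([0, +oo); L^2), differentiable in L^2 for t > 0, solves
   (D_t + Delta-tilde) psi = 0 for t > 0, where D_t = -i d/dt, and
   psi = phi at t = 0. *)
Definition schroedinger_solution (phi : R * R -> R[i])
    (psi : R -> R * R -> R[i]) : Prop :=
  [/\ forall t, 0 <= t -> L2 (psi t),
      forall t, 0 <= t ->
        sqnorm (fun p => psi s p - psi t p)
          @[s --> within `[0, +oo[ (nbhs t)] --> 0%E,
      forall t, 0 < t -> exists v w,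
        [/\ L2_derivative psi t v, lap_graph (psi t) w
          & forall p, 'i^-1 * v p + w p = 0]
    & sqnorm (fun p => psi 0 p - phi p) = 0%E].

End Evolution.

Section Quasimode.
Context {R : realType}.
Variables (m : nat) (alpha beta : R) (h : R).

Definition energy : R[i] :=
  (alpha +i* beta) * (h `^ ((2 * m)%:R / m.+1%:R))%:C.

Definition varpi (x : R) : R[i] :=
  cintegral_from_to 0 x
    (fun y => sqrtc (energy + (m%:R^-1 * y ^+ (2 * m))%:C)).

(* The values of varpi' are in the open first quadrant, where [sqrtc] is
   holomorphic. *)
Definition quasi_u (x : R) : R[i] :=
  (sqrtc (cderive varpi x))^-1 * cexp ('i * varpi x / h%:C).

Definition quasi_utilde (chi0 : R -> R[i]) (x : R) : R[i] :=
  chi0 (x / (h `^ (m.+1%:R^-1))) * quasi_u x.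

End Quasimode.

(* Main.v *)
Require Import Defs.
From HB Require Import structures.
From mathcomp Require Import all_boot all_order all_algebra complex.
From mathcomp Require Import all_classical all_reals all_analysis.
From mathcomp Require Import measurable_realfun ring lra.

Set Implicit Arguments.
Unset Strict Implicit.
Unset Printing Implicit Defensive.

Import Order.TTheory GRing.Theory Num.Theory.
Import numFieldNormedType.Exports.

Local Open Scope classical_set_scope.
Local Open Scope ring_scope.
Local Open Scope complex_scope.

(** The statement is an uncertainty principle at the scale
    [gamma = h ^ (1 / (m + 1))] of the datum: during a time of order [gamma ^ 2]
    the Schroedinger flow only rotates the phase of the datum, and the datum is a
    single Fourier mode in the angle, on which [<D_theta>] is the scalar
    [<k> = jap k].

    The phase of the quasimode is homogeneous: the substitution [x = gamma s]
    turns [varpi x / h] into a function of [s] alone, because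
    [gamma ^ (m + 1) = h]. So [utilde] is a multiple of [v (x / gamma)] for one
    fixed smooth profile [v] supported in [[-2, 2]], with [v 0 != 0]
    ([quasi_utilde_scaling]). For such a datum
    [phi = exp (i k theta) utilde (x)], the function [lap phi + k ^ 2 phi] is
    [exp (i k theta)] times
    [utilde'' + (k ^ 2 (1 - A ^ -2) - V1) utilde]. On the support,
    [d ^ 2 / d x ^ 2] costs [gamma ^ -2], the coefficient
    [k ^ 2 (1 - A ^ -2)] is at most
    [k ^ 2 x ^ (2 m) <= 4 ^ m gamma ^ -2], and [V1] is bounded. Hence this
    residual has norm at most [C gamma ^ -2] times the norm of [phi]
    ([residual_bound]).

    Let [psi] be a solution. Since [lap] is symmetric on smooth compactly
    supported functions, its closure has a real quadratic form, so the mass of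
    [psi] is conserved ([mass_conservation]), and pairing with [phi] moves [lap]
    onto [phi] ([lap_graph_weak]). The real part of
    [<psi t, exp (i k ^ 2 t) phi>] ([correlation]) therefore has a derivative
    which only involves the residual, of size at most
    [2 C gamma ^ -2 |phi| ^ 2]. It starts at [|phi| ^ 2], so it stays above
    [|phi| ^ 2 / 2] up to the time [gamma ^ 2 / A0] once [A0 >= 4 C]
    ([correlation_lower_bound]).

    Finally, if [g = <D_theta> chi psi], then [<g, phi> = <k> <psi, phi>] because
    [chi = 1] where [utilde] lives ([japD_rip]), and Cauchy-Schwarz gives
    [|g| ^ 2 >= <k> ^ 2 |phi| ^ 2 / 16] ([japD_sqnorm_correlation_ge]).
    Integrating over a time [gamma ^ 2 / A0] costs the factor [gamma ^ 2], which
    is at least [<k> ^ (- 2 / (m + 1))]; what remains is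
    [<k> ^ (2 m / (m + 1)) |phi| ^ 2], the squared norm of
    [<D_theta> ^ (m / (m + 1)) phi]. *)

(** * Functions of one variable of class C^n *)
Section SmoothFunctions.
Context {R : realType}.
Implicit Types (f g : R -> R) (n : nat) (x : R).

Fixpoint Ck n f : Prop :=
  continuous f /\
  if n is n'.+1 then (forall x, derivable f x 1) /\ Ck n' (derive1 f) else True.

Definition Cinf f : Prop := forall n, Ck n f.

Lemma is_derive_continuous f (g : R -> R) :
  (forall x, is_derive x 1 f (g x)) -> continuous f.
Proof.
move=> fg x; apply: differentiable_continuous; apply/derivable1_diffP.
by have [] := fg x.
Qed.

Lemma is_derive_derive1 f (g : R -> R) :
  (forall x, is_derive x 1 f (g x)) -> (derive1 f) = g.
Proof.
by move=> fg; apply/funext => x; rewrite derive1E; have [_ ->] := fg x.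
Qed.

Lemma Ck_is_derive n f (g : R -> R) :
  (forall x, is_derive x 1 f (g x)) -> Ck n g -> Ck n.+1 f.
Proof.
move=> fg gn; split; first exact: is_derive_continuous fg.
by rewrite (is_derive_derive1 fg); split.
Qed.

Lemma Ck_continuous n f : Ck n f -> continuous f.
Proof. by case: n => [|n] []. Qed.

Lemma CkS n f : Ck n.+1 f ->
  (forall x, is_derive x 1 f ((derive1 f) x)) /\ Ck n (derive1 f).
Proof.
move=> [_ [df fn]]; split => // x; rewrite derive1E.
exact: derivableP.
Qed.

Lemma CkW n f : Ck n.+1 f -> Ck n f.
Proof.
elim: n f => [|n IH] f [cf [df fn]]; first by split.
by split => //; split => //; apply: IH.
Qed.

Lemma Ck_cst n (c : R) : Ck n (fun=> c).
Proof.
elim: n c => [|n IH] c; first by split => // x; exact: cvg_cst.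
by apply: (Ck_is_derive (g := fun=> 0)) => // x; exact: is_derive_cst.
Qed.

Lemma Ck_id n : Ck n (fun x : R => x).
Proof.
case: n => [|n]; first by split => // x; exact: cvg_id.
by apply: (Ck_is_derive (g := fun=> 1)) (Ck_cst _ _) => x; exact: is_derive_id.
Qed.

Lemma CkD n f g : Ck n f -> Ck n g -> Ck n (fun x => f x + g x).
Proof.
elim: n f g => [|n IH] f g.
  by move=> [cf _] [cg _]; split=> // x; apply: continuousD; [exact: cf|exact: cg].
move=> /CkS[df fn] /CkS[dg gn].
by apply: Ck_is_derive (IH _ _ fn gn) => ?.
Qed.

Lemma CkM n f g : Ck n f -> Ck n g -> Ck n (fun x => f x * g x).
Proof.
elim: n f g => [|n IH] f g.
  by move=> [cf _] [cg _]; split=> // x; apply: continuousM; [exact: cf|exact: cg].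
move=> fn1 gn1; have [/CkS[df fn] /CkS[dg gn]] := (fn1, gn1).
apply: Ck_is_derive (CkD (IH _ _ (CkW fn1) gn) (IH _ _ (CkW gn1) fn)) => ?.
Qed.

Lemma CkZ n (c : R) f : Ck n f -> Ck n (fun x => c * f x).
Proof. by move=> fn; apply: CkM => //; exact: Ck_cst. Qed.

Lemma CkN n f : Ck n f -> Ck n (fun x => - f x).
Proof.
move=> /(CkZ (- 1)); congr Ck; apply/funext => x; exact: mulN1r.
Qed.

Lemma CkB n f g : Ck n f -> Ck n g -> Ck n (fun x => f x - g x).
Proof. by move=> fn gn; apply: CkD => //; exact: CkN. Qed.

Lemma CkX n f j : Ck n f -> Ck n (fun x => f x ^+ j).
Proof.
move=> fn; elim: j => [|j IH]; first exact: Ck_cst.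
by under eq_fun do rewrite exprS; exact: CkM.
Qed.

Lemma CkV n f : (forall x, f x != 0) -> Ck n f -> Ck n (fun x => (f x)^-1).
Proof.
move=> f0; elim: n => [[cf _]|n IH fn1].
  by split => // x; apply: cvgV => //; exact: cf.
have [df fn] := CkS fn1.
have fV2 : Ck n (fun x => - (f x)^-1 ^+ 2).
  by apply: CkN; apply: CkX; apply: IH; exact: CkW.
apply: Ck_is_derive (CkM fV2 fn) => x; rewrite exprVn.
exact: is_deriveV.
Qed.

(** Induction on the order: the derivative of the composite is the composite
    itself times [f'], so its regularity is the induction hypothesis. *)
Lemma Ck_exp n f : Ck n f -> Ck n (fun x => expR (f x)).
Proof.
elim: n => [[cf _]|n IH fn1].
  by split => // x; apply: continuous_comp; [exact: cf|exact: continuous_expR].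
have [df fn] := CkS fn1.
apply: Ck_is_derive (CkM (IH (CkW fn1)) fn) => ?.
Qed.

Lemma Ck_sincos n f : Ck n f ->
  Ck n (fun x => sin (f x)) /\ Ck n (fun x => cos (f x)).
Proof.
elim: n => [[cf _]|n IH fn1].
  by split; split => // x; apply: continuous_comp (cf x) _;
     [exact: continuous_sin|exact: continuous_cos].
have [df fn] := CkS fn1; have [sn cn] := IH (CkW fn1).
split.
  by apply: Ck_is_derive (CkM cn fn) => x.
by apply: Ck_is_derive (CkM (CkN sn) fn) => ?.
Qed.

Lemma Ck_sin n f : Ck n f -> Ck n (fun x => sin (f x)).
Proof. by case/Ck_sincos. Qed.

Lemma Ck_cos n f : Ck n f -> Ck n (fun x => cos (f x)).
Proof. by case/Ck_sincos. Qed.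

Lemma Ck_sqrt n f : (forall x, 0 < f x) -> Ck n f ->
  Ck n (fun x => Num.sqrt (f x)).
Proof.
move=> f0; elim: n => [[cf _]|n IH fn1].
  by split => // x; apply: continuous_comp; [exact: cf|exact: sqrt_continuous].
have [df fn] := CkS fn1.
have sV : Ck n (fun x => (2 * Num.sqrt (f x))^-1).
  apply: CkV (CkZ _ (IH (CkW fn1))) => x.
  by rewrite mulf_neq0// gt_eqF ?sqrtr_gt0.
apply: Ck_is_derive (CkM sV fn) => x.
have := is_derive1_sqrt (f0 x) => ?; exact: is_derive1_comp.
Qed.

Lemma Ck_ln n f : (forall x, 0 < f x) -> Ck n f -> Ck n (fun x => ln (f x)).
Proof.
move=> f0; case: n => [[cf _]|n fn1].
  by split => // x; apply: continuous_comp; [exact: cf|exact: continuous_ln].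
have [df fn] := CkS fn1.
have fV : Ck n (fun x => (f x)^-1) by apply: CkV (CkW fn1) => x; rewrite gt_eqF.
apply: Ck_is_derive (CkM fV fn) => x.
have := is_derive1_ln (f0 x) => ?; exact: is_derive1_comp.
Qed.

Lemma smooth1_Cinf f : smooth1 f -> Cinf f.
Proof.
move=> sf n; elim: n f sf => [|n IH] f sf.
  split => // x; apply: differentiable_continuous; apply/derivable1_diffP.
  exact: (sf 0%N).
apply: (Ck_is_derive (g := (derive1 f))) => [x|].
  by rewrite derive1E; apply: derivableP; exact: (sf 0%N).
by apply: IH => j x; have := sf j.+1 x; rewrite derive1Sn.
Qed.

Lemma Ck_scale n (c : R) f : Ck n f -> Ck n (fun x => f (x * c)).
Proof.
elim: n f => [|n IH] f.
  move=> [cf _]; split => // x; apply: (@continuous_comp _ _ _ (fun x => x * c)).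
    by apply: continuousM; [exact: cvg_id|exact: cvg_cst].
  exact: cf.
move=> /CkS[df fn].
apply: Ck_is_derive (CkZ c (IH _ fn)) => x.
have := df (x * c) => ?; rewrite mulrC.
apply: (@is_derive1_comp _ f (fun x => x * c)).
by apply: is_derive_eq; rewrite /GRing.scale/= mulr0 add0r mulr1.
Qed.

End SmoothFunctions.

(** * The real Hilbert space structure of complex-valued square integrable functions *)
Section ComplexParts.
Context {R : realType}.
Implicit Types (z w : R[i]).

Lemma cReD z w : complex.Re (z + w) = complex.Re z + complex.Re w.
Proof. by case: z; case: w. Qed.
Lemma cImD z w : complex.Im (z + w) = complex.Im z + complex.Im w.
Proof. by case: z; case: w. Qed.
Lemma cReN z : complex.Re (- z) = - complex.Re z.
Proof. by case: z. Qed.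
Lemma cImN z : complex.Im (- z) = - complex.Im z.
Proof. by case: z. Qed.
Lemma cReM z w :
  complex.Re (z * w) = complex.Re z * complex.Re w - complex.Im z * complex.Im w.
Proof. by case: z; case: w. Qed.
Lemma cImM z w :
  complex.Im (z * w) = complex.Re z * complex.Im w + complex.Im z * complex.Re w.
Proof. by case: z; case: w. Qed.

Definition cReIm := (cReD, cImD, cReN, cImN, cReM, cImM).

Lemma eqRI z w : complex.Re z = complex.Re w -> complex.Im z = complex.Im w ->
  z = w.
Proof. by case: z; case: w => a b c d /= -> ->. Qed.

Lemma abs2_ge0 z : 0 <= abs2 z.
Proof. by rewrite addr_ge0 ?sqr_ge0. Qed.

Lemma abs2M z w : abs2 (z * w) = abs2 z * abs2 w.
Proof. by rewrite /abs2 !cReIm; ring. Qed.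

End ComplexParts.

Section SquareIntegrable.
Context d (T : measurableType d) (R : realType).
Variables (mu : {measure set T -> \bar R}) (D : set T).
Hypothesis mD : measurable D.
Implicit Types (F G H : T -> R).

Definition sqint F : Prop :=
  measurable_fun D F /\ (\int[mu]_(x in D) (F x ^+ 2)%:E < +oo)%E.

Definition ip F G : R := \int[mu]_(x in D) (F x * G x).

Lemma sqint_integrable F : sqint F ->
  mu.-integrable D (EFin \o (fun x => F x ^+ 2)).
Proof.
move=> [mF Foo]; apply/integrableP; split.
  by apply/measurable_EFinP; exact: measurable_funX.
under eq_integral do rewrite /= ger0_norm ?sqr_ge0//.
exact: Foo.
Qed.

Lemma integrable_sqint F : measurable_fun D F ->
  mu.-integrable D (EFin \o (fun x => F x ^+ 2)) -> sqint F.
Proof.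
move=> mF /integrableP[_ Foo]; split => //; move: Foo.
by under eq_integral do rewrite /= ger0_norm ?sqr_ge0//.
Qed.

Lemma integrable_Rle (F G : T -> R) : measurable_fun D F ->
  mu.-integrable D (EFin \o G) -> (forall x, D x -> `|F x| <= G x) ->
  mu.-integrable D (EFin \o F).
Proof.
move=> mF iG FG; apply: (le_integrable mD) iG.
  exact/measurable_EFinP.
by move=> x Dx /=; rewrite lee_fin (le_trans (FG _ Dx))// ler_norm.
Qed.

Lemma integrable_RD (F G : T -> R) : mu.-integrable D (EFin \o F) ->
  mu.-integrable D (EFin \o G) -> mu.-integrable D (EFin \o (fun x => F x + G x)).
Proof. by move=> iF iG; have := integrableD mD iF iG; apply. Qed.

Lemma integrable_RZ (c : R) (F : T -> R) : mu.-integrable D (EFin \o F) ->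
  mu.-integrable D (EFin \o (fun x => c * F x)).
Proof. by move=> iF; have := integrableZl mD c iF; apply. Qed.

Lemma sqintM F G : sqint F -> sqint G ->
  mu.-integrable D (EFin \o (fun x => F x * G x)).
Proof.
move=> sF sG; apply: (@integrable_Rle _ (fun x => F x ^+ 2 + G x ^+ 2)).
- by apply: measurable_funM; [exact: sF.1|exact: sG.1].
- by apply: integrable_RD; exact: sqint_integrable.
- move=> x _; rewrite ler_norml; have := sqr_ge0 (F x + G x).
  by have := sqr_ge0 (F x - G x) => *; apply/andP; split; nra.
Qed.

Lemma sqintD F G : sqint F -> sqint G -> sqint (fun x => F x + G x).
Proof.
move=> sF sG; have mFG : measurable_fun D (fun x => F x + G x).
  by apply: measurable_funD; [exact: sF.1|exact: sG.1].
apply: integrable_sqint => //.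
apply: (@integrable_Rle _ (fun x => 2 * (F x ^+ 2 + G x ^+ 2))).
- exact: measurable_funX.
- by apply: integrable_RZ; apply: integrable_RD; exact: sqint_integrable.
- move=> x _; rewrite ger0_norm ?sqr_ge0//.
  by have := sqr_ge0 (F x - G x) => *; nra.
Qed.

Lemma sqintZ (c : R) F : sqint F -> sqint (fun x => c * F x).
Proof.
move=> sF; have mF : measurable_fun D (fun x => c * F x).
  by apply: measurable_funM; [exact: measurable_cst|exact: sF.1].
apply: integrable_sqint => //.
under eq_fun do rewrite exprMn.
by apply: integrable_RZ; exact: sqint_integrable.
Qed.

Lemma ipC F G : ip F G = ip G F.
Proof. by apply: eq_Rintegral => x _; rewrite mulrC. Qed.

Lemma ipDl F G H : sqint F -> sqint G -> sqint H ->
  ip (fun x => F x + G x) H = ip F H + ip G H.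
Proof.
move=> sF sG sH; rewrite /ip -RintegralD//; try exact: sqintM.
by apply: eq_Rintegral => x _; rewrite mulrDl.
Qed.

Lemma ipZl (c : R) F G : sqint F -> sqint G -> ip (fun x => c * F x) G = c * ip F G.
Proof.
move=> sF sG; rewrite /ip -RintegralZl//; last exact: sqintM.
by apply: eq_Rintegral => x _; rewrite mulrA.
Qed.

Lemma ip_ge0 F : 0 <= ip F F.
Proof. by apply: Rintegral_ge0 => x _; rewrite -expr2 sqr_ge0. Qed.

Implicit Types (f g h : T -> R[i]).

Definition csqint f : Prop :=
  sqint (fun x => complex.Re (f x)) /\ sqint (fun x => complex.Im (f x)).

(** The real part of the complex inner product; its imaginary part is recovered
    by multiplying one of the arguments by ['i]. *)
Definition rip f g : R :=
  ip (fun x => complex.Re (f x)) (fun x => complex.Re (g x)) +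
  ip (fun x => complex.Im (f x)) (fun x => complex.Im (g x)).

Lemma csqintD f g : csqint f -> csqint g -> csqint (fun x => f x + g x).
Proof.
move=> [f1 f2] [g1 g2]; split.
  by under eq_fun do rewrite cReD; exact: sqintD.
by under eq_fun do rewrite cImD; exact: sqintD.
Qed.

Lemma csqintZ (c : R[i]) f : csqint f -> csqint (fun x => c * f x).
Proof.
move=> [f1 f2]; split.
  under eq_fun do rewrite cReM -mulNr.
  by apply: sqintD; exact: sqintZ.
under eq_fun do rewrite cImM.
by apply: sqintD; exact: sqintZ.
Qed.

Lemma csqintB f g : csqint f -> csqint g -> csqint (fun x => f x - g x).
Proof.
move=> sf sg; under eq_fun do rewrite -(mulN1r (g _)).
by apply: csqintD => //; exact: csqintZ.
Qed.

Lemma ripC f g : rip f g = rip g f.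
Proof. by rewrite /rip ipC [X in _ + X]ipC. Qed.

Lemma ripDl f g h : csqint f -> csqint g -> csqint h ->
  rip (fun x => f x + g x) h = rip f h + rip g h.
Proof.
move=> [f1 f2] [g1 g2] [h1 h2]; rewrite /rip.
under [X in ip X _]eq_fun do rewrite cReD.
under [X in _ + ip X _]eq_fun do rewrite cImD.
by rewrite !ipDl//; ring.
Qed.

(** For the real inner product, multiplication by ['i] is skew-adjoint. *)
Lemma ripZl (c : R[i]) f g : csqint f -> csqint g ->
  rip (fun x => c * f x) g =
  complex.Re c * rip f g - complex.Im c * rip f (fun x => 'i * g x).
Proof.
move=> [f1 f2] [g1 g2]; rewrite /rip.
under [X in ip X _]eq_fun do rewrite cReM -mulNr.
under [X in _ + ip X _]eq_fun do rewrite cImM.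
under [X in _ = _ - _ * (ip _ X + _)]eq_fun do rewrite cReM /= mul0r sub0r mul1r -mulN1r.
under [X in _ = _ - _ * (_ + ip _ X)]eq_fun do rewrite cImM /= mul0r add0r mul1r.
rewrite !ipDl ?ipZl//; try exact: sqintZ.
rewrite [ip _ (fun x => -1 * _)]ipC ipZl// [ip (fun x => complex.Im (g x)) _]ipC.
by ring.
Qed.

End SquareIntegrable.

Section CauchySchwarz.
Context d (T : measurableType d) (R : realType).
Variables (mu : {measure set T -> \bar R}) (D : set T).
Hypothesis mD : measurable D.
Implicit Types (f g h : T -> R[i]).
Local Notation csqint := (csqint mu D).
Local Notation rip := (rip mu D).
Local Notation nrm f := (Num.sqrt (rip f f)).

Lemma rip_ge0 f : 0 <= rip f f.
Proof. by rewrite addr_ge0// ip_ge0. Qed.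

Lemma ripDr f g h : csqint f -> csqint g -> csqint h ->
  rip h (fun x => f x + g x) = rip h f + rip h g.
Proof. by move=> sf sg sh; rewrite ripC ripDl// !(ripC _ _ h). Qed.

Lemma ripZrl (c : R) f g : csqint f -> csqint g ->
  rip (fun x => c%:C * f x) g = c * rip f g.
Proof. by move=> sf sg; rewrite ripZl//= mul0r subr0. Qed.

Lemma ripZrr (c : R) f g : csqint f -> csqint g ->
  rip f (fun x => c%:C * g x) = c * rip f g.
Proof. by move=> sf sg; rewrite ripC ripZrl// ripC. Qed.

Lemma ripil f g : csqint f -> csqint g ->
  rip (fun x => 'i * f x) g = - rip f (fun x => 'i * g x).
Proof. by move=> sf sg; rewrite ripZl//= mul0r mul1r sub0r. Qed.

Lemma ripNl f g : csqint f -> csqint g ->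
  rip (fun x => - f x) g = - rip f g.
Proof.
move=> sf sg; under [X in rip X _]eq_fun do rewrite -mulN1r.
rewrite (_ : -1 = (-1)%:C :> R[i]); last by rewrite rmorphN.
by rewrite ripZrl// mulN1r.
Qed.

Lemma csqintN f : csqint f -> csqint (fun x => - f x).
Proof. by move=> sf; under eq_fun do rewrite -mulN1r; exact: csqintZ. Qed.

Lemma ripBl f g h : csqint f -> csqint g -> csqint h ->
  rip (fun x => f x - g x) h = rip f h - rip g h.
Proof.
by move=> sf sg sh; rewrite ripDl ?ripNl//; exact: csqintN.
Qed.

Lemma ripBr f g h : csqint f -> csqint g -> csqint h ->
  rip h (fun x => f x - g x) = rip h f - rip h g.
Proof. by move=> sf sg sh; rewrite ripC ripBl// !(ripC _ _ h). Qed.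

Lemma rip_subrr f : rip (fun x => f x - f x) (fun x => f x - f x) = 0.
Proof.
have -> : (fun x => f x - f x) = (fun=> 0) by apply/funext => x; rewrite subrr.
have z : ip mu D (fun=> 0) (fun=> 0) = 0.
  by rewrite /ip; under eq_Rintegral do rewrite mulr0; rewrite /Rintegral integral0.
by rewrite /rip /= z addr0.
Qed.

(** Discriminant of the nonnegative polynomial
    [l |-> rip (f + l g) (f + l g)]. *)
Lemma rip_CS f g : csqint f -> csqint g -> `|rip f g| <= nrm f * nrm g.
Proof.
move=> sf sg; set a := rip f f; set c := rip g g; set b := rip f g.
have quad (l : R) : 0 <= a + l * b *+ 2 + l ^+ 2 * c.
  have slg := csqintZ mD l%:C sg.
  have := rip_ge0 (fun x => f x + l%:C * g x).
  rewrite ripDl ?ripDr ?ripZrl ?ripZrr//; try exact: csqintD.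
  rewrite (ripC _ _ g f) -/a -/b -/c; congr (0 <= _); ring.
have a0 : 0 <= a by exact: rip_ge0.
have c0 : 0 <= c by exact: rip_ge0.
have bac : b ^+ 2 <= a * c.
  have [c_eq0|c_neq0] := eqVneq c 0.
    have [->|b0] := eqVneq b 0; first by rewrite expr0n/= mulr_ge0.
    have := quad (- (a + 1) / (2 * b)); rewrite c_eq0.
    have -> : - (a + 1) / (2 * b) * b *+ 2 = - (a + 1).
      by rewrite -mulr_natr; field.
    by lra.
  have := quad (- b / c).
  have -> : a + - b / c * b *+ 2 + (- b / c) ^+ 2 * c = (a * c - b ^+ 2) / c.
    by rewrite -mulr_natr; field.
  by rewrite pmulr_lge0 ?subr_ge0// invr_gt0 lt_neqAle eq_sym c_neq0.
rewrite -sqrtrM// -sqrtr_sqr.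
by rewrite ler_wsqrtr.
Qed.

Lemma cvg0_squeeze {I : Type} (F : set_system I) {FF : Filter F}
  (u v : I -> R) : (\forall i \near F, `|u i| <= v i) ->
  v i @[i --> F] --> 0 -> u i @[i --> F] --> 0.
Proof.
move=> uv v0; apply: (@squeeze_cvgr _ _ _ _ (fun i => - v i) v) => //.
  by near=> i; rewrite -ler_norml; near: i.
by rewrite -oppr0; exact: cvgN.
Unshelve. all: by end_near. Qed.

(** Expand around the limits: each error term has a factor which tends to [0]. *)
Lemma rip_cvg {I : Type} (F : set_system I) {FF : Filter F}
    (fs gs : I -> T -> R[i]) f g :
  (\forall i \near F, csqint (fs i)) -> (\forall i \near F, csqint (gs i)) ->
  csqint f -> csqint g ->
  rip (fun x => fs i x - f x) (fun x => fs i x - f x) @[i --> F] --> 0 ->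
  rip (fun x => gs i x - g x) (fun x => gs i x - g x) @[i --> F] --> 0 ->
  rip (fs i) (gs i) @[i --> F] --> rip f g.
Proof.
move=> sfs sgs sf sg cf cg.
have sqrt0 (u : I -> R) : u i @[i --> F] --> 0 ->
    Num.sqrt (u i) @[i --> F] --> 0.
  by move=> u0; rewrite -(@sqrtr0 R); apply: continuous_cvg => //; exact: sqrt_continuous.
pose df i x := fs i x - f x; pose dg i x := gs i x - g x.
have h1 : rip (df i) (dg i) @[i --> F] --> 0.
  apply: (@cvg0_squeeze _ _ _ _ (fun i => nrm (df i) * nrm (dg i))).
    near=> i; apply: rip_CS; apply: csqintB => //; near: i; [exact: sfs|exact: sgs].
  by rewrite -(mulr0 0); apply: cvgM; exact: sqrt0.
have h2 : rip (df i) g @[i --> F] --> 0.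
  apply: (@cvg0_squeeze _ _ _ _ (fun i => nrm (df i) * nrm g)).
    near=> i; apply: rip_CS => //; apply: csqintB => //; near: i; exact: sfs.
  by rewrite -(mul0r (nrm g)); apply: cvgMl; exact: sqrt0.
have h3 : rip f (dg i) @[i --> F] --> 0.
  apply: (@cvg0_squeeze _ _ _ _ (fun i => nrm f * nrm (dg i))).
    near=> i; apply: rip_CS => //; apply: csqintB => //; near: i; exact: sgs.
  by rewrite -(mulr0 (nrm f)); apply: cvgMr; exact: sqrt0.
have : rip (df i) (dg i) + rip (df i) g + rip f (dg i) + rip f g @[i --> F]
    --> rip f g.
  rewrite -[X in _ --> X]add0r -[X in _ --> X + _]addr0 -[X in _ --> X + _ + _]addr0.
  by apply: cvgD; [apply: cvgD => //; exact: cvgD|exact: cvg_cst].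
apply: cvg_trans; apply: near_eq_cvg; near=> i.
have sfi : csqint (fs i) by near: i; exact: sfs.
have sgi : csqint (gs i) by near: i; exact: sgs.
rewrite /df /dg !ripBl ?ripBr//; try exact: csqintB.
by ring.
Unshelve. all: by end_near. Qed.

End CauchySchwarz.

(** * Integration on the cylinder *)
Section CylinderMeasure.
Context {R : realType}.
Local Notation leb := (@lebesgue_measure R).
Local Notation MT := (g_sigma_algebraType (R.-ocitv.-measurable)).

Local Notation cyl_measure := (leb \x leb)%E.
Local Notation FD := (@fundamental_domain R).

Lemma measurable_FD : measurable (FD : set (MT * MT)).
Proof. by apply: measurableX => //; exact: measurable_itv. Qed.

(** The plane has a countable base of rectangles, so the product sigma-algebra
    contains the open sets. *)
Lemma open_measurable_plane (U : set (R * R)) : open U ->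
  measurable (U : set (MT * MT)).
Proof.
move=> oU.
pose rect (q : (rat * rat) * (rat * rat)) : set (R * R) :=
  `]ratr q.1.1, ratr q.1.2[ `*` `]ratr q.2.1, ratr q.2.2[.
pose W q := if `[< rect q `<=` U >] then rect q else set0.
have -> : U = \bigcup_q W q.
  apply/seteqP; split => [[x y] Uxy|p [q _]]; last first.
    by rewrite /W; case: asboolP => // qU; apply: qU.
  have /nbhs_ballP[e /= e0 eU] := open_nbhs_nbhs (conj oU Uxy).
  have rat_near (z : R) : exists a b : rat,
      [/\ z - e < ratr a < z & z < ratr b < z + e].
    have /rat_in_itvoo[a] : z - e < z by rewrite ltrBlDr ltrDl.
    have /rat_in_itvoo[b] : z < z + e by rewrite ltrDl.
    by rewrite !in_itv/= => zb za; exists a, b.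
  have [a [b [/andP[a1 a2] /andP[b1 b2]]]] := rat_near x.
  have [c [d [/andP[c1 c2] /andP[d1 d2]]]] := rat_near y.
  exists ((a, b), (c, d)) => //; rewrite /W asboolT.
    by rewrite /rect/=; split; rewrite /= in_itv/=; apply/andP.
  move=> [x' y'] [/=]; rewrite !in_itv/= => /andP[x1 x2] /andP[y1 y2].
  by apply: eU; split => /=; rewrite /ball/= ltr_norml; apply/andP; split; lra.
apply: countable_bigcupT_measurable => // q; rewrite /W.
case: ifPn => _ //; apply: measurableX; exact: measurable_itv.
Qed.

Lemma continuous_measurable_plane (F : R * R -> R) : continuous F ->
  measurable_fun [set: MT * MT] F.
Proof.
move=> /continuousP cF.
apply: (measurability _ (RGenOInfty.measurableE R)).
move=> /= _ [_ [a ->]] <-; apply: measurableI => //.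
by apply: open_measurable_plane; apply: cF; exact: interval_open.
Qed.

Lemma continuous_measurable_FD (F : R * R -> R) : continuous F ->
  measurable_fun (FD : set (MT * MT)) F.
Proof. by move=> /continuous_measurable_plane; exact: measurable_funTS. Qed.

Definition box (a : R) : set (R * R) := `[- a, a] `*` `[0, 2 * pi].

Lemma twopi_ge0 : 0 <= 2 * pi :> R.
Proof. by rewrite mulr_ge0 ?pi_ge0. Qed.

Lemma measurable_box a : measurable (box a : set (MT * MT)).
Proof. by apply: measurableX; exact: measurable_itv. Qed.

Lemma box_measure a : 0 <= a -> cyl_measure (box a) = (2 * a * (2 * pi))%:E.
Proof.
move=> a0; transitivity (leb [set` `[(- a)%R, a]] * leb [set` `[0%R, (2 * pi)%R]])%E.
  by apply: product_measure1E; exact: measurable_itv.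
rewrite !lebesgue_measure_itv/= !lte_fin; have := twopi_ge0 => p0.
case: ltP => [_|aa]; last first.
  have -> : a = 0 by lra.
  by rewrite mul0e mulr0 mul0r.
case: ltP => [_|pp]; first by rewrite !EFinN !oppeK -!EFinD -EFinM; congr EFin; ring.
by have -> : 2 * pi = 0 :> R by [lra|apply/eqP; rewrite eq_le pp p0]; rewrite mule0 mulr0.
Qed.

Lemma box_subFD a : box a `<=` FD.
Proof. by move=> p [_ ?]; split. Qed.

Lemma integrable_box (a K : R) : 0 <= a ->
  cyl_measure.-integrable FD (EFin \o (fun p => K * \1_(box a) p)).
Proof.
move=> a0; apply: (integrable_RZ measurable_FD); apply/integrableP; split.
  apply/measurable_EFinP; apply: measurable_indic; exact: measurable_box.
under eq_integral do rewrite /= ger0_norm//.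
rewrite integral_indic; [|exact: measurable_FD|exact: measurable_box].
rewrite setIidl; last exact: box_subFD.
by rewrite [X in (X < _)%E](box_measure a0) ltry.
Qed.

Lemma Rintegral_box (a K : R) : 0 <= a ->
  \int[cyl_measure]_(p in FD) (K * \1_(box a) p) = K * (2 * a * (2 * pi)).
Proof.
move=> a0; rewrite RintegralZl; last 2 first.
- exact: measurable_FD.
- by have := @integrable_box a 1 a0; under eq_fun do rewrite mul1r.
rewrite /Rintegral integral_indic; [|exact: measurable_FD|exact: measurable_box].
rewrite setIidl; last exact: box_subFD.
by rewrite [X in fine X](box_measure a0).
Qed.

Lemma bounded_support_integrable (F : R * R -> R) (a K : R) : 0 <= a ->
  measurable_fun (FD : set (MT * MT)) F ->
  (forall p, FD p -> `|F p| <= K * \1_(box a) p) ->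
  cyl_measure.-integrable FD (EFin \o F).
Proof.
move=> a0 mF FK.
apply: (integrable_Rle measurable_FD mF (G := fun p => K * \1_(box a) p)) => //.
exact: integrable_box.
Qed.

Lemma continuous_bounded_box (F : R * R -> R) (a : R) : continuous F ->
  exists2 K, 0 <= K & forall p, box a p -> `|F p| <= K.
Proof.
move=> cF; have cb : compact (box a) by apply: compact_setX; exact: segment_compact.
have /compact_bounded[M [_ FM]] : compact (F @` box a).
  by apply: continuous_compact => //; exact: continuous_subspaceT.
exists (`|M| + 1) => [|p bp]; first by rewrite addr_ge0.
by apply: FM; [rewrite ltr_pwDr// ler_norm|exists p].
Qed.

Definition xsupported (a : R) (F : R * R -> R) : Prop :=
  forall p : R * R, a < `|p.1| -> F p = 0.

Lemma continuous_support_bound (F : R * R -> R) (a : R) : 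
  continuous F -> xsupported a F ->
  exists2 K, 0 <= K & forall p, FD p -> `|F p| <= K * \1_(box a) p.
Proof.
move=> cF sF; have [K K0 FK] := continuous_bounded_box a cF.
exists K => // p [_ p2]; rewrite indicE.
have [ap|pa] := ltP a `|p.1|; first by rewrite sF// normr0 mulr_ge0.
rewrite mem_set ?mulr1; last by split => //=; rewrite in_itv/= -ler_norml.
by apply: FK; split => //=; rewrite in_itv/= -ler_norml.
Qed.

Lemma continuous_support_integrable (F : R * R -> R) (a : R) : 0 <= a ->
  continuous F -> xsupported a F ->
  cyl_measure.-integrable FD (EFin \o F).
Proof.
move=> a0 cF sF; have [K K0 FK] := continuous_support_bound cF sF.
by apply: (bounded_support_integrable a0 _ FK); exact: continuous_measurable_FD.
Qed.

Lemma continuous_slice1 (F : R * R -> R) (y : R) : continuous F ->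
  continuous (fun x => F (x, y)).
Proof.
move=> cF x; apply: (@continuous_comp _ _ _ (fun x : R => (x, y)) F); last exact: cF.
exact: (@cvg_pair _ _ _ (nbhs x) (nbhs x) (nbhs y) _ _ _ id (cst y)
  cvg_id (cvg_cst _)).
Qed.

Lemma continuous_slice2 (F : R * R -> R) (x : R) : continuous F ->
  continuous (fun y => F (x, y)).
Proof.
move=> cF y; apply: (@continuous_comp _ _ _ (fun y : R => (x, y)) F); last exact: cF.
exact: (@cvg_pair _ _ _ (nbhs y) (nbhs x) (nbhs y) _ _ _ (cst x) id
  (cvg_cst _) cvg_id).
Qed.

Lemma FTC_segment (f g : R -> R) (a b : R) : a < b ->
  (forall x : R, is_derive x 1 f (g x)) -> continuous g ->
  (\int[leb]_(x in `[a, b]) (g x)%:E = (f b - f a)%:E)%E.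
Proof.
move=> ab fg cg; have cf := is_derive_continuous fg.
rewrite (@continuous_FTC2 _ g f)//; first exact: continuous_subspaceT.
  split; first by move=> x _; have [] := fg x.
    by apply: cvg_at_right_filter; exact: cf.
  by apply: cvg_at_left_filter; exact: cf.
by move=> x _; rewrite (is_derive_derive1 fg).
Qed.

Lemma FTC_support (f g : R -> R) (a : R) : 0 <= a ->
  (forall x : R, is_derive x 1 f (g x)) -> continuous g ->
  (forall x, a < `|x| -> f x = 0) -> (forall x, a < `|x| -> g x = 0) ->
  (\int[leb]_x (g x)%:E = 0)%E.
Proof.
move=> a0 fg cg f0 g0.
have a1 : a < `|a + 1| by rewrite ger0_norm ?addr_ge0// ltrDl.
have -> : (fun x => (g x)%:E) = (fun x => (g x)%:E) \_ `[- (a + 1), a + 1].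
  apply/funext => x; rewrite patchE; case: ifPn => // /negP xa.
  rewrite g0// ltNge; apply/negP => xa'; apply: xa; rewrite inE/= in_itv/=.
  by rewrite -ler_norml (le_trans xa')// lerDl.
rewrite -integral_mkcond (FTC_segment (f := f))//; last by lra.
by rewrite !f0 ?subr0// normrN.
Qed.

Lemma FD_integral_eq0_x (H : R * R -> R) :
  cyl_measure.-integrable FD (EFin \o H) ->
  (forall y, (\int[leb]_x (H (x, y))%:E = 0)%E) ->
  \int[cyl_measure]_(p in FD) H p = 0.
Proof.
move=> iH H0; rewrite /Rintegral integral_mkcond -integral21_prod_meas1.
  rewrite /fubini_G integral0_eq// => y _.
  have [yI|yI] := boolP (y \in `[0, 2 * pi]).
    rewrite -[RHS](H0 y); apply: eq_integral => x _.
    by rewrite patchE mem_set//; split.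
  rewrite integral0_eq// => x _; rewrite patchE memNset//.
  by move=> [_ /=]; apply/negP.
exact: (proj1 (@integrable_mkcond _ _ _ cyl_measure _ (EFin \o H) measurable_FD) iH).
Qed.

Lemma FD_integral_iterated (H : R * R -> R) :
  cyl_measure.-integrable FD (EFin \o H) ->
  (\int[cyl_measure]_(p in FD) (H p)%:E =
   \int[leb]_x \int[leb]_(y in `[0%R, (2 * pi)%R]) (H (x, y))%:E)%E.
Proof.
move=> iH; rewrite integral_mkcond -integral12_prod_meas1.
  rewrite /fubini_F; apply: eq_integral => x _.
  rewrite [RHS]integral_mkcond; apply: eq_integral => y _; rewrite !patchE.
  congr (if _ then _ else _).
  by apply/idP/idP => /set_mem h; apply: mem_set; [case: h|split].
exact: (proj1 (@integrable_mkcond _ _ _ cyl_measure _ (EFin \o H) measurable_FD) iH).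
Qed.

End CylinderMeasure.

(** * Symmetry of the conjugated Laplacian *)
Section Coefficients.
Context {R : realType}.
Variable m : nat.
Local Notation Afun := (@Afun R m).
Local Notation V1 := (@V1 R m).

Lemma even_power_ge0 (x : R) : 0 <= x ^+ (2 * m).
Proof. by rewrite exprM exprn_ge0// sqr_ge0. Qed.

Lemma Afun_gt0 (x : R) : 0 < Afun x.
Proof. by rewrite powR_gt0// ltr_wpDr// even_power_ge0. Qed.

Lemma Afun_Cinf : Cinf Afun.
Proof.
have b0 (x : R) : 0 < 1 + x ^+ (2 * m) by rewrite ltr_wpDr// even_power_ge0.
have -> : Afun = (fun x => expR ((2 * m)%:R^-1 * ln (1 + x ^+ (2 * m)))).
  by apply/funext => x; rewrite /Defs.Afun /powR gt_eqF.
move=> n; apply: Ck_exp; apply: CkZ; apply: Ck_ln => //.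
by apply: CkD; [exact: Ck_cst|apply: CkX; exact: Ck_id].
Qed.

Lemma AfunV2_continuous : continuous (fun x => Afun x ^- 2).
Proof.
apply: (@Ck_continuous _ 0); under eq_fun do rewrite -exprVn; apply: CkX; apply: CkV (Afun_Cinf 0).
by move=> x; rewrite gt_eqF// Afun_gt0.
Qed.

Lemma V1_continuous : continuous V1.
Proof.
have [_ [_ cA1]] := Afun_Cinf 2; have [_ [_ cA2]] := cA1.
have CV : Ck 0 (fun x => (Afun x)^-1).
  by apply: CkV (Afun_Cinf 0) => x; rewrite gt_eqF// Afun_gt0.
apply: (@Ck_continuous _ 0); apply: CkB.
  by apply: CkM => //; apply: CkZ; rewrite derive1nS derive1n1.
apply: CkM; last by under eq_fun do rewrite -exprVn; exact: CkX.
by apply: CkZ; apply: CkX; exact: CkW.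
Qed.

(** Near the circle [x = 0], the metric is flat up to the order [2 m]. *)
Lemma AfunV2_near1 (x : R) : (0 < m)%N -> `|Afun x ^- 2 - 1| <= x ^+ (2 * m).
Proof.
move=> m0; set y := x ^+ (2 * m); have y0 : 0 <= y := even_power_ge0 x.
have A1 : 1 <= Afun x ^+ 2.
  rewrite -(powR_mulrn _ (ltW (Afun_gt0 x))) /Defs.Afun -powRrM -/y.
  rewrite -[X in X <= _](powRr0 (1 + y)).
  by rewrite ler_powR ?lerDl// mulr_ge0// invr_ge0.
have A2 : Afun x ^+ 2 <= 1 + y.
  rewrite -(powR_mulrn _ (ltW (Afun_gt0 x))) /Defs.Afun -powRrM -/y.
  rewrite -[X in _ <= X]powRr1 ?addr_ge0//.
  rewrite ler_powR ?lerDl// natrM invfM mulrAC mulVf// mul1r.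
  by rewrite invf_le1 ?ltr0n// ler1n.
set a := Afun x ^+ 2 in A1 A2 *; have a0 : 0 < a by exact: lt_le_trans A1.
have w0 : 0 < a^-1 by rewrite invr_gt0.
have wa : a^-1 * a = 1 by rewrite mulVf// gt_eqF.
have w1 : a^-1 <= 1 by rewrite invf_le1.
by rewrite ler_norml; apply/andP; split; nra.
Qed.

End Coefficients.

Section SmoothCylinder.
Context {R : realType}.
Implicit Types (F G : R * R -> R).

Lemma CnS n F : Cn n.+1 F ->
  [/\ forall x y : R, is_derive x 1 (fun x => F (x, y)) (pdx F (x, y)),
      forall x y : R, is_derive y 1 (fun y => F (x, y)) (pdtheta F (x, y)),
      Cn n (pdx F) & Cn n (pdtheta F)].
Proof.
move=> [_ [dx dy Fx Fy]]; split=> // x y; rewrite /pdx /pdtheta/= derive1E;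
  apply: derivableP; [exact: (dx (x, y))|exact: (dy (x, y))].
Qed.

Lemma Cn_continuous n F : Cn n F -> continuous F.
Proof. by case: n => [|n] []. Qed.

Lemma pdx_eq F (g : R * R -> R) :
  (forall x y : R, is_derive x 1 (fun x => F (x, y)) (g (x, y))) -> pdx F = g.
Proof.
move=> Fg; apply/funext => -[x y]; rewrite /pdx/= derive1E.
by have [_ ->] := Fg x y.
Qed.

Lemma pdtheta_eq F (g : R * R -> R) :
  (forall x y : R, is_derive y 1 (fun y => F (x, y)) (g (x, y))) -> pdtheta F = g.
Proof.
move=> Fg; apply/funext => -[x y]; rewrite /pdtheta/= derive1E.
by have [_ ->] := Fg x y.
Qed.

Lemma Cn_is_derive n F (g1 g2 : R * R -> R) : continuous F ->
  (forall x y : R, is_derive x 1 (fun x => F (x, y)) (g1 (x, y))) ->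
  (forall x y : R, is_derive y 1 (fun y => F (x, y)) (g2 (x, y))) ->
  Cn n g1 -> Cn n g2 -> Cn n.+1 F.
Proof.
move=> cF F1 F2 Cg1 Cg2; split => //; split.
- by move=> [x y]; have [] := F1 x y.
- by move=> [x y]; have [] := F2 x y.
- by rewrite (pdx_eq F1).
- by rewrite (pdtheta_eq F2).
Qed.

Lemma CnD n F G : Cn n F -> Cn n G -> Cn n (fun p => F p + G p).
Proof.
elim: n F G => [|n IH] F G.
  by move=> [cF _] [cG _]; split => // x; apply: continuousD; [exact: cF|exact: cG].
move=> Fn Gn; have [Fx Fy Fxn Fyn] := CnS Fn; have [Gx Gy Gxn Gyn] := CnS Gn.
apply: Cn_is_derive (IH _ _ Fxn Gxn) (IH _ _ Fyn Gyn).
by move=> p; apply: continuousD; [exact: (Cn_continuous Fn)|exact: (Cn_continuous Gn)].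
Qed.

Lemma continuous_fst (f : R -> R) : continuous f -> continuous (fun p : R * R => f p.1).
Proof.
move=> cf p; apply: (@continuous_comp _ _ _ fst f); last exact: cf.
exact: cvg_fst.
Qed.

Lemma continuous_snd (f : R -> R) : continuous f -> continuous (fun p : R * R => f p.2).
Proof.
move=> cf p; apply: (@continuous_comp _ _ _ snd f); last exact: cf.
exact: cvg_snd.
Qed.

Lemma Cn_tensor n (f g : R -> R) : Ck n f -> Ck n g -> Cn n (fun p => f p.1 * g p.2).
Proof.
elim: n f g => [|n IH] f g fn gn.
  split=> // p; apply: continuousM.
    by apply: continuous_fst; exact: Ck_continuous fn.
  by apply: continuous_snd; exact: Ck_continuous gn.
have [df f'n] := CkS fn; have [dg g'n] := CkS gn.
apply: Cn_is_derive (IH _ _ f'n (CkW gn)) (IH _ _ (CkW fn) g'n).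
- move=> p; apply: continuousM.
    by apply: continuous_fst; exact: Ck_continuous fn.
  by apply: continuous_snd; exact: Ck_continuous gn.
- move=> x y /=; have -> : (fun x0 => f x0 * g y) = (g y \*: f).
    by apply/funext => z /=; rewrite mulrC.
  by rewrite mulrC; exact: is_deriveZ.
- by move=> x y /=; exact: is_deriveZ.
Qed.

(** The scalar components of [Cc_infty_cyl], with an explicit support radius. *)
Definition smooth_cyl (a : R) F : Prop :=
  [/\ forall n, Cn n F, forall x y : R, F (x, y + 2 * pi) = F (x, y)
    & xsupported a F].

Lemma smooth_cyl_continuous a F : smooth_cyl a F -> continuous F.
Proof. by move=> [/(_ 0%N) [] ]. Qed.

Lemma smooth_cyl_is_derive a F : smooth_cyl a F ->
  (forall x y : R, is_derive x 1 (fun x => F (x, y)) (pdx F (x, y))) /\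
  (forall x y : R, is_derive y 1 (fun y => F (x, y)) (pdtheta F (x, y))).
Proof. by move=> [/(_ 1%N)/CnS[]]. Qed.

Lemma derive1_supported (a : R) (f : R -> R) : (forall x, a < `|x| -> f x = 0) ->
  forall x, a < `|x| -> derive1 f x = 0.
Proof.
move=> f0 x ax; rewrite derive1E (@near_eq_derive _ _ _ _ (cst 0)) ?derive_cst//.
have : nbhs x [set z | a < `|z|].
  apply: open_nbhs_nbhs; split => //.
  apply: (@open_comp _ _ (fun z : R => `|z|) [set z | a < z]).
    by move=> z _; exact: norm_continuous.
  exact: open_gt.
by apply: filterS => z /= az; exact: f0.
Qed.

Lemma smooth_cyl_pdx a F : smooth_cyl a F -> smooth_cyl a (pdx F).
Proof.
move=> [Fn Fp F0]; split => [n|x y|[x y] /= ax].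
- by have [] := CnS (Fn n.+1).
- by rewrite /pdx/=; congr derive1; apply/funext => z; exact: Fp.
- by apply: (derive1_supported (a := a) (f := fun z => F (z, y))) => // z az; exact: F0.
Qed.

(** Periodicity of the angular derivative is what cancels the boundary terms at
    [0] and [2 pi]. *)
Lemma smooth_cyl_pdtheta a F : smooth_cyl a F -> smooth_cyl a (pdtheta F).
Proof.
move=> sF; have [_ dF] := smooth_cyl_is_derive sF.
case: (sF) => [Fn Fp F0]; split => [n|x y|[x y] /= ax].
- by have [] := CnS (Fn n.+1).
- rewrite [RHS]/pdtheta/=; have -> : (fun y => F (x, y)) = (fun y => F (x, y + 2 * pi)).
    by apply/funext => z; rewrite Fp.
  rewrite derive1E; apply/esym.
  have d : is_derive y 1 (fun z => F (x, z + 2 * pi)) (pdtheta F (x, y + 2 * pi) * 1).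
    apply: (@is_derive1_comp _ (fun z => F (x, z)) (fun z => z + 2 * pi)).
    by apply: is_derive_eq; rewrite addr0.
  by have [_ ->] := d; rewrite mulr1.
- rewrite /pdtheta/=; have -> : (fun z => F (x, z)) = cst 0.
    by apply/funext => z; exact: F0.
  by rewrite derive1_cst.
Qed.

End SmoothCylinder.

Section LaplacianSymmetry.
Context {R : realType}.
Variables (m : nat) (a : R).
Hypothesis a0 : 0 <= a.
Implicit Types (F G : R * R -> R).
Local Notation leb := (@lebesgue_measure R).
Local Notation cyl_measure := (leb \x leb)%E.
Local Notation FD := (@fundamental_domain R).
Local Notation smooth_cyl := (smooth_cyl a).

Definition rlap F : R * R -> R := fun p =>
  pdx (pdx F) p + Afun m p.1 ^- 2 * pdtheta (pdtheta F) p - V1 m p.1 * F p.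

Lemma continuous_RM F G : continuous F -> continuous G ->
  continuous (fun p => F p * G p).
Proof. by move=> cF cG p; apply: continuousM; [exact: cF|exact: cG]. Qed.

Lemma continuous_RB F G : continuous F -> continuous G ->
  continuous (fun p => F p - G p).
Proof. by move=> cF cG p; apply: continuousB; [exact: cF|exact: cG]. Qed.

Lemma continuous_RD F G : continuous F -> continuous G ->
  continuous (fun p => F p + G p).
Proof. by move=> cF cG p; apply: continuousD; [exact: cF|exact: cG]. Qed.

Lemma is_derive_wronskian (f f' g g' : R -> R) (f'' g'' x : R) :
  is_derive x 1 f (f' x) -> is_derive x 1 f' f'' ->
  is_derive x 1 g (g' x) -> is_derive x 1 g' g'' ->
  is_derive x 1 (fun x => f' x * g x - f x * g' x) (f'' * g x - f x * g'').
Proof.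
move=> df df' dg dg'.
have h := is_deriveB (is_deriveM df' dg) (is_deriveM df dg').
by apply: (is_derive_eq h); rewrite /GRing.scale/=; ring.
Qed.

(** Integrate the exact derivative of the Wronskian of [F] and [G] in [x]. *)
Lemma pdx2_symmetric F G : smooth_cyl F -> smooth_cyl G ->
  \int[cyl_measure]_(p in FD) (pdx (pdx F) p * G p - F p * pdx (pdx G) p) = 0.
Proof.
move=> sF sG; have [sFx sGx] := (smooth_cyl_pdx sF, smooth_cyl_pdx sG).
have [sFxx sGxx] := (smooth_cyl_pdx sFx, smooth_cyl_pdx sGx).
have [cF cG] := (smooth_cyl_continuous sF, smooth_cyl_continuous sG).
have [cFxx cGxx] := (smooth_cyl_continuous sFxx, smooth_cyl_continuous sGxx).
have cH : continuous (fun p => pdx (pdx F) p * G p - F p * pdx (pdx G) p).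
  by apply: continuous_RB; exact: continuous_RM.
have [_ _ F0] := sF; have [_ _ G0] := sG.
apply: FD_integral_eq0_x => [|y].
  apply: (@continuous_support_integrable _ _ a) => // p ap.
  by rewrite F0// G0// mulr0 mul0r subr0.
apply: (@FTC_support _ (fun x => pdx F (x, y) * G (x, y) - F (x, y) * pdx G (x, y)) _ a) => //.
- move=> x.
  have [[dF _] [dG _]] := (smooth_cyl_is_derive sF, smooth_cyl_is_derive sG).
  have [[dFx _] [dGx _]] := (smooth_cyl_is_derive sFx, smooth_cyl_is_derive sGx).
  exact: (is_derive_wronskian (dF x y) (dFx x y) (dG x y) (dGx x y)).
- exact: (continuous_slice1 (F := fun p => pdx (pdx F) p * G p - F p * pdx (pdx G) p)).
- by move=> x ax; rewrite F0// G0// mulr0 mul0r subr0.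
- by move=> x ax; rewrite F0// G0// mulr0 mul0r subr0.
Qed.

(** The Wronskian in the angle is periodic, and the weight [c] is constant along
    the circles. *)
Lemma pdtheta2_symmetric (c : R -> R) F G : continuous c ->
  smooth_cyl F -> smooth_cyl G ->
  \int[cyl_measure]_(p in FD)
    (c p.1 * (pdtheta (pdtheta F) p * G p - F p * pdtheta (pdtheta G) p)) = 0.
Proof.
move=> cc sF sG; have [sFx sGx] := (smooth_cyl_pdtheta sF, smooth_cyl_pdtheta sG).
have [sFxx sGxx] := (smooth_cyl_pdtheta sFx, smooth_cyl_pdtheta sGx).
have [cF cG] := (smooth_cyl_continuous sF, smooth_cyl_continuous sG).
have [cFxx cGxx] := (smooth_cyl_continuous sFxx, smooth_cyl_continuous sGxx).
have cH : continuous (fun p => pdtheta (pdtheta F) p * G p - F p * pdtheta (pdtheta G) p).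
  by apply: continuous_RB; exact: continuous_RM.
have [_ Fp F0] := sF; have [_ Gp G0] := sG.
have [_ Fxp _] := sFx; have [_ Gxp _] := sGx.
rewrite /Rintegral FD_integral_iterated; last first.
  apply: (@continuous_support_integrable _ _ a) => //.
    by apply: continuous_RM => //; exact: continuous_fst.
  by move=> p ap; rewrite F0// G0// mulr0 mul0r subr0 mulr0.
rewrite integral0_eq// => x _ /=.
have [pi0|pi0] := ltP 0 (2 * pi : R); last first.
  have /eqP pi2 : 2 * pi == 0 :> R by rewrite eq_le pi0 twopi_ge0.
  by rewrite pi2 set_itv1 integral_set1.
pose W y := c x * (pdtheta F (x, y) * G (x, y) - F (x, y) * pdtheta G (x, y)).
pose W' y := c x * (pdtheta (pdtheta F) (x, y) * G (x, y)
  - F (x, y) * pdtheta (pdtheta G) (x, y)).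
have dW (y : R) : is_derive y 1 W (W' y).
  have [[_ dF] [_ dG]] := (smooth_cyl_is_derive sF, smooth_cyl_is_derive sG).
  have [[_ dFx] [_ dGx]] := (smooth_cyl_is_derive sFx, smooth_cyl_is_derive sGx).
  exact: (is_deriveZ (c x) (is_derive_wronskian (dF x y) (dFx x y) (dG x y) (dGx x y))).
have cW' : continuous W'.
  apply: (@Ck_continuous _ 0); apply: CkZ; split => //.
  exact: (continuous_slice2 (F := fun p => pdtheta (pdtheta F) p * G p
    - F p * pdtheta (pdtheta G) p)).
rewrite [LHS](FTC_segment pi0 dW cW') /W.
by rewrite -(add0r (2 * pi)) Fp Gp Fxp Gxp subrr.
Qed.

Lemma continuous_rlap F : smooth_cyl F -> continuous (rlap F).
Proof.
move=> sF.
have cFxx := smooth_cyl_continuous (smooth_cyl_pdx (smooth_cyl_pdx sF)).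
have cFyy := smooth_cyl_continuous (smooth_cyl_pdtheta (smooth_cyl_pdtheta sF)).
apply: continuous_RB.
  apply: continuous_RD => //; apply: continuous_RM => //.
  exact: (continuous_fst (@AfunV2_continuous R m)).
apply: continuous_RM; last exact: smooth_cyl_continuous sF.
exact: (continuous_fst (@V1_continuous R m)).
Qed.

Lemma rlap_xsupported F : smooth_cyl F -> xsupported a (rlap F).
Proof.
move=> sF p ap; rewrite /rlap.
have [_ _ ->//] := smooth_cyl_pdx (smooth_cyl_pdx sF).
have [_ _ ->//] := smooth_cyl_pdtheta (smooth_cyl_pdtheta sF).
by have [_ _ ->//] := sF; rewrite !mulr0 addr0 subr0.
Qed.

Lemma rlap_symmetric F G : smooth_cyl F -> smooth_cyl G ->
  ip cyl_measure FD (rlap F) G = ip cyl_measure FD F (rlap G).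
Proof.
move=> sF sG.
have [cF cG] := (smooth_cyl_continuous sF, smooth_cyl_continuous sG).
have [cLF cLG] := (continuous_rlap sF, continuous_rlap sG).
have [_ _ F0] := sF; have [_ _ G0] := sG.
have iH H : continuous H -> xsupported a H -> cyl_measure.-integrable FD (EFin \o H).
  exact: continuous_support_integrable.
apply/eqP; rewrite -subr_eq0 /ip -RintegralB; last 3 first.
- exact: measurable_FD.
- apply: (iH (fun p => rlap F p * G p)); first exact: continuous_RM.
  by move=> p ap; rewrite G0// mulr0.
- apply: (iH (fun p => F p * rlap G p)); first exact: continuous_RM.
  by move=> p ap; rewrite F0// mul0r.
pose H1 p := pdx (pdx F) p * G p - F p * pdx (pdx G) p.
pose H2 p := Afun m p.1 ^- 2 * (pdtheta (pdtheta F) p * G p - F p * pdtheta (pdtheta G) p).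
have -> : (fun p => rlap F p * G p - F p * rlap G p) = (fun p => H1 p + H2 p).
  apply/funext => p; rewrite /rlap /H1 /H2.
  by move: (pdx _ _) (pdtheta _ _) (pdx _ _) (pdtheta _ _) => *; ring.
have cFxx := smooth_cyl_continuous (smooth_cyl_pdx (smooth_cyl_pdx sF)).
have cFyy := smooth_cyl_continuous (smooth_cyl_pdtheta (smooth_cyl_pdtheta sF)).
have cGxx := smooth_cyl_continuous (smooth_cyl_pdx (smooth_cyl_pdx sG)).
have cGyy := smooth_cyl_continuous (smooth_cyl_pdtheta (smooth_cyl_pdtheta sG)).
rewrite RintegralD; last 3 first.
- exact: measurable_FD.
- apply: (iH H1); first by apply: continuous_RB; exact: continuous_RM.
  by move=> p ap; rewrite /H1 F0// G0// mulr0 mul0r subr0.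
- apply: (iH H2).
    apply: continuous_RM; first exact: (continuous_fst (@AfunV2_continuous R m)).
    by apply: continuous_RB; exact: continuous_RM.
  by move=> p ap; rewrite /H2 F0// G0// mulr0 mul0r subr0 mulr0.
rewrite pdx2_symmetric// add0r; apply/eqP.
exact: (pdtheta2_symmetric (@AfunV2_continuous R m) sF sG).
Qed.

End LaplacianSymmetry.

(** * The quadratic form on the cylinder *)
Section CylinderL2.
Context {R : realType}.
Implicit Types (f g : R * R -> R[i]).
Local Notation leb := (@lebesgue_measure R).
Local Notation cyl_measure := (leb \x leb)%E.
Local Notation FD := (@fundamental_domain R).

Local Notation Crip := (rip cyl_measure FD).
Local Notation Csq := (csqint cyl_measure FD).

Lemma L2_csqint f : L2 f -> Csq f.
Proof.
move=> [_ m1 m2 foo].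
have hle (F : R * R -> R) : (forall p, F p ^+ 2 <= abs2 (f p)) ->
    measurable_fun FD F ->
    (\int[cyl_measure]_(p in FD) (F p ^+ 2)%:E < +oo)%E.
  move=> Ff mF; apply: le_lt_trans foo; apply: ge0_le_integral.
  - exact: measurable_FD.
  - by move=> p _; rewrite lee_fin sqr_ge0.
  - by apply/measurable_EFinP; exact: measurable_funX.
  - apply/measurable_EFinP; apply: measurable_funD; exact: measurable_funX.
  - by move=> p _; rewrite lee_fin.
split; split => //; apply: hle => // p; rewrite /abs2.
  by rewrite lerDl sqr_ge0.
by rewrite lerDr sqr_ge0.
Qed.

Lemma sqnorm_rip f : Csq f -> sqnorm f = (Crip f f)%:E.
Proof.
move=> [sf1 sf2]; rewrite /sqnorm /rip /ip.
have i1 := sqint_integrable sf1; have i2 := sqint_integrable sf2.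
rewrite EFinD !fineK; last 2 first.
- by apply: integrable_fin_num; [exact: measurable_FD|under eq_fun do rewrite /= -expr2].
- by apply: integrable_fin_num; [exact: measurable_FD|under eq_fun do rewrite /= -expr2].
rewrite -integralD_EFin; [|exact: measurable_FD|..].
- by apply: eq_integral => p _; rewrite /abs2 !expr2.
- by under eq_fun do rewrite /= -expr2.
- by under eq_fun do rewrite /= -expr2.
Qed.

Lemma L2_of_csqint f : periodic_theta f -> Csq f -> L2 f.
Proof.
move=> pf sf; have [[m1 _] [m2 _]] := sf; split => //.
by rewrite sqnorm_rip// ltry.
Qed.

Lemma sqnorm_cvg0 {I : Type} (F : set_system I) {FF : Filter F}
    (fs : I -> R * R -> R[i]) : (\forall i \near F, Csq (fs i)) ->
  sqnorm (fs i) @[i --> F] --> 0%E -> Crip (fs i) (fs i) @[i --> F] --> 0.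
Proof.
move=> sfs h; have : fine (sqnorm (fs i)) @[i --> F] --> (0 : R).
  exact: (@fine_cvg _ _ _ _ (fun i => sqnorm (fs i))).
apply: cvg_trans; apply: near_eq_cvg; near=> i.
by rewrite sqnorm_rip//; near: i.
Unshelve. all: by end_near. Qed.

End CylinderL2.

(** * Weak form of the Laplacian and the Schroedinger evolution *)
Section GraphOfLaplacian.
Context {R : realType}.
Variable m : nat.
Implicit Types (f g : R * R -> R[i]).
Local Notation leb := (@lebesgue_measure R).
Local Notation cyl_measure := (leb \x leb)%E.
Local Notation FD := (@fundamental_domain R).
Local Notation Crip := (rip cyl_measure FD).
Local Notation Csq := (csqint cyl_measure FD).
Local Notation Cre f := (fun p : R * R => complex.Re (f p)).
Local Notation Cim f := (fun p : R * R => complex.Im (f p)).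

Lemma rip_ii f g : Csq f -> Csq g ->
  Crip (fun p => 'i * f p) (fun p => 'i * g p) = Crip f g.
Proof.
move=> sf sg; have mFD := @measurable_FD R.
rewrite (ripil mFD sf (csqintZ mFD 'i%R sg)).
have -> : (fun p => 'i * ('i * g p)) = (fun p => - g p).
  by apply/funext => p; rewrite mulrA -expr2 sqr_i mulN1r.
by rewrite ripC (ripNl mFD)// opprK ripC.
Qed.

Lemma smooth_cylW (a b : R) (F : R * R -> R) : a <= b ->
  smooth_cyl a F -> smooth_cyl b F.
Proof.
by move=> ab [Fn Fp F0]; split=> // p bp; apply: F0; exact: le_lt_trans ab bp.
Qed.

Lemma Cc_infty_cylP f : Cc_infty_cyl f <->
  exists2 a, 0 <= a & smooth_cyl a (Cre f) /\ smooth_cyl a (Cim f).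
Proof.
split=> [[pf f1 f2 [M fM]]|[a a0 [[f1 p1 s1] [f2 p2 s2]]]].
  exists `|M| => //; have MM p : `|M| < `|p.1| -> f p = 0.
    by move=> h; apply: fM; exact: le_lt_trans (ler_norm _) h.
  by split; split=> // [x y|p /MM -> //]; rewrite pf.
split => //; first by move=> x y; apply: eqRI; [exact: p1|exact: p2].
by exists a => p ap; apply: eqRI; [exact: s1|exact: s2].
Qed.

Lemma Re_lap f p : complex.Re (lap m f p) = rlap m (Cre f) p.
Proof.
rewrite /lap /rlap cReN cReD cReD cReN cReN !cReM /=.
by rewrite /cpdx /cpdtheta /=; move: (pdx _ _) (pdtheta _ _) => *; ring.
Qed.

Lemma Im_lap f p : complex.Im (lap m f p) = rlap m (Cim f) p.
Proof.
rewrite /lap /rlap cImN cImD cImD cImN cImN !cImM /=.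
by rewrite /cpdx /cpdtheta /=; move: (pdx _ _) (pdtheta _ _) => *; ring.
Qed.

Lemma continuous_support_sqint (a : R) (F : R * R -> R) : 0 <= a ->
  continuous F -> xsupported a F -> sqint cyl_measure FD F.
Proof.
move=> a0 cF sF; apply: integrable_sqint; first exact: continuous_measurable_FD.
apply: (continuous_support_integrable (F := fun p => F p ^+ 2) a0).
  by under eq_fun do rewrite expr2; exact: continuous_RM.
by move=> p ap; rewrite sF// expr0n.
Qed.

Lemma Cc_infty_cyl_csqint f : Cc_infty_cyl f -> Csq f.
Proof.
move=> /Cc_infty_cylP[a a0 [s1 s2]]; have [[_ _ z1] [_ _ z2]] := (s1, s2).
by split; apply: (@continuous_support_sqint a) => //;
  [exact: smooth_cyl_continuous s1|exact: smooth_cyl_continuous s2].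
Qed.

Lemma lap_csqint f : Cc_infty_cyl f -> Csq (lap m f).
Proof.
move=> /Cc_infty_cylP[a a0 [s1 s2]]; split.
  under eq_fun do rewrite Re_lap; apply: (@continuous_support_sqint a) => //.
    exact: continuous_rlap s1.
  exact: rlap_xsupported.
under eq_fun do rewrite Im_lap; apply: (@continuous_support_sqint a) => //.
  exact: continuous_rlap s2.
exact: rlap_xsupported.
Qed.

Lemma Cc_infty_cyl_common_support f g : Cc_infty_cyl f -> Cc_infty_cyl g ->
  exists2 a, 0 <= a & 
  [/\ smooth_cyl a (Cre f), smooth_cyl a (Cim f), smooth_cyl a (Cre g)
    & smooth_cyl a (Cim g)].
Proof.
move=> /Cc_infty_cylP[a a0 [f1 f2]] /Cc_infty_cylP[b b0 [g1 g2]].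
exists (Num.max a b); first by rewrite le_max a0.
by split; [move: f1|move: f2|move: g1|move: g2]; apply: smooth_cylW;
  rewrite le_max lexx ?orbT.
Qed.

Lemma lap_symmetric f g : Cc_infty_cyl f -> Cc_infty_cyl g ->
  Crip (lap m f) g = Crip f (lap m g).
Proof.
move=> cf cg; have [a a0 [f1 f2 g1 g2]] := Cc_infty_cyl_common_support cf cg.
rewrite /rip; congr (_ + _).
  under [X in ip _ _ X _]eq_fun do rewrite Re_lap.
  under [X in _ = ip _ _ _ X]eq_fun do rewrite Re_lap.
  exact: (rlap_symmetric _ a0).
under [X in ip _ _ X _]eq_fun do rewrite Im_lap.
under [X in _ = ip _ _ _ X]eq_fun do rewrite Im_lap.
exact: (rlap_symmetric _ a0).
Qed.

Lemma rip_i f g : Csq f -> Csq g ->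
  Crip f (fun p => 'i * g p) = ip cyl_measure FD (Cim f) (Cre g)
                             - ip cyl_measure FD (Cre f) (Cim g).
Proof.
move=> [f1 f2] [g1 g2]; have mFD := @measurable_FD R; rewrite /rip.
under [X in ip _ _ _ X + _]eq_fun do rewrite cReM /= mul0r sub0r mul1r -mulN1r.
under [X in _ + ip _ _ _ X]eq_fun do rewrite cImM /= mul0r add0r mul1r.
by rewrite ipC (ipZl mFD)// mulN1r addrC [in X in _ - X]ipC.
Qed.

Lemma lap_symmetric_i f g : Cc_infty_cyl f -> Cc_infty_cyl g ->
  Crip (lap m f) (fun p => 'i * g p) = Crip f (fun p => 'i * lap m g p).
Proof.
move=> cf cg; have [a a0 [f1 f2 g1 g2]] := Cc_infty_cyl_common_support cf cg.
rewrite !rip_i; try exact: lap_csqint; try exact: Cc_infty_cyl_csqint.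
congr (_ - _).
  under [X in ip _ _ X _]eq_fun do rewrite Im_lap.
  under [X in _ = ip _ _ _ X]eq_fun do rewrite Re_lap.
  exact: (rlap_symmetric _ a0).
under [X in ip _ _ X _]eq_fun do rewrite Re_lap.
under [X in _ = ip _ _ _ X]eq_fun do rewrite Im_lap.
exact: (rlap_symmetric _ a0).
Qed.

Lemma lap_graph_approx f g : lap_graph m f g ->
  exists u : nat -> R * R -> R[i],
  [/\ forall j, Cc_infty_cyl (u j),
      Crip (fun p => u j p - f p) (fun p => u j p - f p) @[j --> \oo] --> 0
    & Crip (fun p => lap m (u j) p - g p) (fun p => lap m (u j) p - g p)
        @[j --> \oo] --> 0].
Proof.
move=> [/L2_csqint sf /L2_csqint sg [u [cu uf ug]]]; exists u; split=> //.
  apply: sqnorm_cvg0 uf; apply: nearW => j; apply: csqintB => //.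
    exact: measurable_FD.
  exact: Cc_infty_cyl_csqint.
apply: sqnorm_cvg0 ug; apply: nearW => j; apply: csqintB => //.
  exact: measurable_FD.
exact: lap_csqint.
Qed.

(** The closure of [lap] is contained in its adjoint: the symmetry passes to the
    limit along an approximating sequence. *)
Lemma lap_graph_weak f g phi : lap_graph m f g -> Cc_infty_cyl phi ->
  Crip g phi = Crip f (lap m phi) /\
  Crip g (fun p => 'i * phi p) = Crip f (fun p => 'i * lap m phi p).
Proof.
move=> fg cphi; have [u [cu uf ug]] := lap_graph_approx fg.
have [/L2_csqint sf /L2_csqint sg _] := fg.
have mFD := @measurable_FD R.
have sphi := Cc_infty_cyl_csqint cphi; have slphi := lap_csqint cphi.
have cst0 h : Crip (fun p => h p - h p) (fun p => h p - h p) @[_ --> \oo] --> 0.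
  by rewrite rip_subrr; exact: cvg_cst.
have lim1 h : Csq h -> Crip (lap m (u j)) h @[j --> \oo] --> Crip g h.
  move=> sh; apply: (rip_cvg mFD _ _ sg sh ug (cst0 h)).
    by apply: nearW => j; exact: lap_csqint.
  exact: nearW.
have lim2 h : Csq h -> Crip (u j) h @[j --> \oo] --> Crip f h.
  move=> sh; apply: (rip_cvg mFD _ _ sf sh uf (cst0 h)).
    by apply: nearW => j; exact: Cc_infty_cyl_csqint.
  exact: nearW.
split.
  apply: (@cvg_unique _ _ (Crip (lap m (u j)) phi @[j --> \oo])) => //.
    exact: lim1.
  have -> : (fun j => Crip (lap m (u j)) phi) = (fun j => Crip (u j) (lap m phi)).
    by apply/funext => j; exact: lap_symmetric.
  exact: lim2.
apply: (@cvg_unique _ _ (Crip (lap m (u j)) (fun p => 'i * phi p) @[j --> \oo])) => //.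
  by apply: lim1; exact: csqintZ.
have -> : (fun j => Crip (lap m (u j)) (fun p => 'i * phi p)) =
          (fun j => Crip (u j) (fun p => 'i * lap m phi p)).
  by apply/funext => j; exact: lap_symmetric_i.
by apply: lim2; exact: csqintZ.
Qed.

(** The quadratic form of the closure is real, as the one of a symmetric
    operator; this is what makes the evolution unitary. *)
Lemma lap_graph_real f g : lap_graph m f g -> Crip g (fun p => 'i * f p) = 0.
Proof.
move=> fg; have [u [cu uf ug]] := lap_graph_approx fg.
have [/L2_csqint sf /L2_csqint sg _] := fg.
have mFD := @measurable_FD R.
have u0 j : Crip (lap m (u j)) (fun p => 'i * u j p) = 0.
  have su := Cc_infty_cyl_csqint (cu j); have sl := lap_csqint (cu j).
  have h : Crip (lap m (u j)) (fun p => 'i * u j p) =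
           - Crip (lap m (u j)) (fun p => 'i * u j p).
    by rewrite {1}lap_symmetric_i// [X in _ = - X]ripC (ripil mFD)// opprK.
  by lra.
have : Crip (lap m (u j)) (fun p => 'i * u j p) @[j --> \oo]
    --> Crip g (fun p => 'i * f p).
  apply: (rip_cvg mFD _ _ sg _ ug).
  - by apply: nearW => j; exact: lap_csqint.
  - by apply: nearW => j; apply: csqintZ => //; exact: Cc_infty_cyl_csqint.
  - exact: csqintZ.
  - have -> : (fun j => Crip (fun p => 'i * u j p - 'i * f p)
        (fun p => 'i * u j p - 'i * f p)) =
      (fun j => Crip (fun p => u j p - f p) (fun p => u j p - f p)).
      apply/funext => j; under [X in Crip X _]eq_fun do rewrite -mulrBr.
      under [X in Crip _ X]eq_fun do rewrite -mulrBr.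
      by apply: rip_ii; apply: csqintB => //; exact: Cc_infty_cyl_csqint.
    exact: uf.
have -> : (fun j => Crip (lap m (u j)) (fun p => 'i * u j p)) = (fun=> 0).
  by apply/funext => j; exact: u0.
by move=> h; apply: (@cvg_unique _ _ ((0:R) @[_ --> \oo])) h (cvg_cst _).
Qed.

End GraphOfLaplacian.

Section Evolution.
Context {R : realType}.
Variable m : nat.
Implicit Types (f g v w : R * R -> R[i]) (s t : R).
Local Notation leb := (@lebesgue_measure R).
Local Notation cyl_measure := (leb \x leb)%E.
Local Notation FD := (@fundamental_domain R).
Local Notation Crip := (rip cyl_measure FD).
Local Notation Csq := (csqint cyl_measure FD).
Local Notation nrm f := (Num.sqrt (Crip f f)).

(** Solutions are differentiable at positive times only; continuity at [0] lets
    the mean value theorem start there. *)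
Lemma halfline_growth (f : R -> R) (B : R) :
  (forall t : R, 0 <= t -> f s @[s --> within `[0, +oo[ (nbhs t)] --> f t) ->
  (forall t : R, 0 < t -> exists2 l, is_derive t 1 f l & `|l| <= B) ->
  forall t : R, 0 <= t -> `|f t - f 0| <= B * t.
Proof.
move=> cf df t; rewrite le_eqVlt => /predU1P[<-|t0].
  by rewrite subrr normr0 mulr0.
have [||c] := @MVT _ f (derive1 f) 0 t t0.
- move=> x; rewrite in_itv/= => /andP[x0 _].
  by have [l [dl <-] _] := df x x0; rewrite derive1E; exact: derivableP.
- apply/subspace_continuousP => x; rewrite /= in_itv/= => /andP[x0 xt].
  apply: cvg_trans (cf x x0); apply: cvg_app; apply: within_subset => y /=.
  by rewrite !in_itv/= andbT => /andP[].
rewrite in_itv/= subr0 => /andP[c0 _] ->.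
have [l [dl <-] Bl] := df c c0.
by rewrite normrM (ger0_norm (ltW t0)) derive1E; exact: (ler_wpM2r (ltW t0)).
Qed.

Section Solution.
Variables (phi : R * R -> R[i]) (psi : R -> R * R -> R[i]).
Hypothesis cphi : Cc_infty_cyl phi.
Hypothesis sol : schroedinger_solution m phi psi.

Let mFD := @measurable_FD R.
Let sphi : Csq phi. Proof. exact: Cc_infty_cyl_csqint. Qed.

Lemma psi_csqint t : 0 <= t -> Csq (psi t).
Proof. by case: sol => L2psi _ _ _ t0; apply: L2_csqint; exact: L2psi. Qed.

Lemma near_halfline t : 0 <= t -> \forall s \near within `[0, +oo[ (nbhs t), Csq (psi s).
Proof.
move=> t0; rewrite near_withinE; near=> s; rewrite /= in_itv/= andbT.
exact: psi_csqint.
Unshelve. all: by end_near. Qed.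

Lemma psi_cvg t : 0 <= t ->
  Crip (fun p => psi s p - psi t p) (fun p => psi s p - psi t p)
    @[s --> within `[0, +oo[ (nbhs t)] --> 0.
Proof.
move=> t0; case: sol => _ /(_ t t0) ct _ _.
apply: sqnorm_cvg0 ct; have := near_halfline t0; apply: filterS => s ss.
by apply: csqintB => //; exact: psi_csqint.
Qed.

Lemma rip_psi_continuous g t : Csq g -> 0 <= t ->
  Crip (psi s) g @[s --> within `[0, +oo[ (nbhs t)] --> Crip (psi t) g.
Proof.
move=> sg t0; apply: (rip_cvg mFD _ _ _ sg (psi_cvg t0)).
- exact: near_halfline.
- exact: nearW.
- exact: psi_csqint.
- by rewrite rip_subrr; exact: cvg_cst.
Qed.

Lemma mass_continuous t : 0 <= t ->
  Crip (psi s) (psi s) @[s --> within `[0, +oo[ (nbhs t)] --> Crip (psi t) (psi t).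
Proof.
move=> t0; apply: (rip_cvg mFD _ _ _ _ (psi_cvg t0) (psi_cvg t0)).
- exact: near_halfline.
- exact: near_halfline.
- exact: psi_csqint.
- exact: psi_csqint.
Qed.

Lemma near_shift_pos t : 0 < t -> \forall s \near (0 : R)^', 0 < t + s.
Proof.
move=> t0; apply: nbhs_dnbhs; have := nbhs0_lt (V := R) t0.
by apply: filterS => s; rewrite ltr_norml => /andP[? _]; lra.
Qed.

Lemma difference_quotient_cvg t v : 0 < t -> L2_derivative psi t v ->
  Crip (fun p => (s^-1)%:C * (psi (t + s) p - psi t p) - v p)
       (fun p => (s^-1)%:C * (psi (t + s) p - psi t p) - v p)
  @[s --> 0^'] --> 0.
Proof.
move=> t0 [/L2_csqint sv]; apply: sqnorm_cvg0.
have := near_shift_pos t0; apply: filterS => s ts0.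
apply: csqintB => //; apply: csqintZ => //; apply: csqintB => //; apply: psi_csqint; exact: ltW.
Qed.

Lemma near_quotient_csqint t : 0 < t -> \forall s \near (0 : R)^',
  Csq (fun p => (s^-1)%:C * (psi (t + s) p - psi t p)).
Proof.
move=> t0; have := near_shift_pos t0; apply: filterS => s ts0.
by apply: csqintZ => //; apply: csqintB => //; apply: psi_csqint; exact: ltW.
Qed.

Lemma is_derive_quotient (f : R -> R) (t l : R) :
  (s^-1 * (f (t + s) - f t) @[s --> 0^'] --> l) -> is_derive t 1 f l.
Proof.
move=> fl.
have fl' : h^-1 *: ((f \o shift t) (h *: (1 : R)) - f t) @[h --> 0^'] --> l.
  apply: cvg_trans fl; apply: near_eq_cvg; apply: nearW => s /=.
  by rewrite /GRing.scale/= mulr1 (addrC s t).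
apply: DeriveDef; first by apply/cvg_ex; exists l.
exact: cvg_lim fl'.
Qed.

Lemma rip_psi_is_derive g t v : Csq g -> 0 < t -> L2_derivative psi t v ->
  is_derive t 1 (fun s => Crip (psi s) g) (Crip v g).
Proof.
move=> sg t0 dv; apply: is_derive_quotient.
have sv : Csq v by case: dv => /L2_csqint.
have : Crip (fun p => (s^-1)%:C * (psi (t + s) p - psi t p)) g @[s --> 0^']
    --> Crip v g.
  apply: (rip_cvg mFD (near_quotient_csqint t0) _ sv sg
    (difference_quotient_cvg t0 dv)); first exact: nearW.
  by rewrite rip_subrr; exact: cvg_cst.
apply: cvg_trans; apply: near_eq_cvg.
have := near_shift_pos t0; apply: filterS => s ts0.
have [st sts] : Csq (psi t) /\ Csq (psi (t + s)).
  by split; apply: psi_csqint; exact: ltW.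
by rewrite (ripZrl mFD _ (csqintB mFD sts st) sg) (ripBl mFD sts st sg).
Qed.

Lemma shift_within t : 0 < t -> (t + s) @[s --> 0^'] --> within `[0, +oo[ (nbhs t).
Proof.
move=> t0 P /=; rewrite /within/= => PP.
have h : (t + s) @[s --> (0 : R)^'] --> t.
  rewrite -[X in _ --> X]addr0; apply: cvgD; first exact: cvg_cst.
  exact: cvg_within.
have := h _ PP; rewrite /nbhs/= => PP'.
near=> s; have := near PP' s; apply => //=.
by rewrite in_itv/= andbT ltW//; near: s; exact: near_shift_pos.
Unshelve. all: by end_near. Qed.

(** As [s] tends to [0], [psi (t + s)] tends to [psi t] strongly, so both factors
    of the quotient [<(psi (t + s) - psi t) / s, psi (t + s) + psi t>] converge. *)
Lemma mass_is_derive t v : 0 < t -> L2_derivative psi t v ->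
  is_derive t 1 (fun s => Crip (psi s) (psi s)) (Crip v (psi t) + Crip v (psi t)).
Proof.
move=> t0 dv; apply: is_derive_quotient.
have sv : Csq v by case: dv => /L2_csqint.
have st : Csq (psi t) by apply: psi_csqint; exact: ltW.
have h1 : Crip (fun p => (s^-1)%:C * (psi (t + s) p - psi t p)) (psi t)
    @[s --> 0^'] --> Crip v (psi t).
  apply: (rip_cvg mFD (near_quotient_csqint t0) _ sv st
    (difference_quotient_cvg t0 dv)); first exact: nearW.
  by rewrite rip_subrr; exact: cvg_cst.
have h2 : Crip (fun p => (s^-1)%:C * (psi (t + s) p - psi t p)) (psi (t + s))
    @[s --> 0^'] --> Crip v (psi t).
  apply: (rip_cvg mFD (near_quotient_csqint t0) _ sv st
    (difference_quotient_cvg t0 dv)).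
    have := near_shift_pos t0; apply: filterS => s ts0.
    by apply: psi_csqint; exact: ltW.
  exact: cvg_comp (shift_within t0) (psi_cvg (ltW t0)).
have : Crip (fun p => (s^-1)%:C * (psi (t + s) p - psi t p)) (psi (t + s)) +
    Crip (fun p => (s^-1)%:C * (psi (t + s) p - psi t p)) (psi t)
    @[s --> 0^'] --> Crip v (psi t) + Crip v (psi t) by exact: cvgD h2 h1.
apply: cvg_trans; apply: near_eq_cvg.
have := near_shift_pos t0; apply: filterS => s ts0.
have sts : Csq (psi (t + s)) by apply: psi_csqint; exact: ltW.
have sB := csqintB mFD sts st.
rewrite /= (ripZrl mFD _ sB sts) (ripZrl mFD _ sB st).
rewrite (ripBl mFD sts st sts) (ripBl mFD sts st st) [X in _ * (_ - X) + _]ripC.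
by move: (rip _ _ _ _) (rip _ _ _ _) (rip _ _ _ _) => *; ring.
Qed.

Lemma generator t : 0 < t -> exists w, [/\ lap_graph m (psi t) w,
  Csq w & L2_derivative psi t (fun p => - ('i * w p))].
Proof.
move=> t0; case: sol => _ _ h _; have [v [w [dv gw vw]]] := h t t0.
exists w; split; [exact: gw|by case: gw => _ /L2_csqint|].
have -> : (fun p => - ('i * w p)) = v; last by [].
apply/funext => p; have := vw p => /eqP; rewrite addr_eq0 => /eqP vwp.
have i0 : ('i : R[i]) != 0 by exact: neq0Ci.
by rewrite -mulrN -vwp mulrA mulfV// mul1r.
Qed.

Lemma mass_conservation t : 0 <= t -> Crip (psi t) (psi t) = Crip (psi 0) (psi 0).
Proof.
move=> t0; apply/eqP; rewrite -subr_eq0 -normr_le0.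
rewrite -[X in _ <= X](mul0r t).
apply: (@halfline_growth (fun s => Crip (psi s) (psi s))) => //.
  exact: mass_continuous.
move=> s s0; have [w [gw sw dw]] := generator s0.
have ss : Csq (psi s) by apply: psi_csqint; exact: ltW.
exists 0; last by rewrite normr0.
apply: is_derive_eq (mass_is_derive s0 dw) _.
rewrite (ripNl mFD (csqintZ mFD 'i%R sw) ss).
by rewrite (ripil mFD sw ss) opprK (lap_graph_real gw) addr0.
Qed.

Lemma psi0_phi g : Csq g -> Crip (psi 0) g = Crip phi g.
Proof.
move=> sg; case: sol => _ _ _ eq0; have s0 := psi_csqint (lexx 0).
have sB := csqintB mFD s0 sphi.
apply/eqP; rewrite -subr_eq0 -(ripBl mFD)// -normr_le0.
apply: le_trans (rip_CS mFD sB sg) _.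
move: eq0; rewrite sqnorm_rip// => -[->].
by rewrite sqrtr0 mul0r.
Qed.

Lemma mass_phi t : 0 <= t -> Crip (psi t) (psi t) = Crip phi phi.
Proof.
move=> t0; rewrite mass_conservation// psi0_phi; last exact: psi_csqint.
by rewrite ripC psi0_phi.
Qed.

(** The real part of [<psi t, exp (i kappa t) phi>]: an exact solution of
    [lap phi = - kappa phi] would evolve by the factor [exp (i kappa t)]. *)
Definition correlation (kappa t : R) : R :=
  cos (kappa * t) * Crip (psi t) phi +
  sin (kappa * t) * Crip (psi t) (fun p => 'i * phi p).

(** The defect of [phi] as an eigenfunction of [lap]. *)
Definition residual (kappa : R) : R * R -> R[i] :=
  fun p => lap m phi p + kappa%:C * phi p.

(** The rotation of the phase is compensated by [lap], up to the defect. *)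
Lemma correlation_is_derive (kappa t : R) : 0 < t ->
  is_derive t 1 (correlation kappa)
    (cos (kappa * t) * Crip (psi t) (fun p => 'i * residual kappa p)
     - sin (kappa * t) * Crip (psi t) (residual kappa)).
Proof.
move=> t0; have [w [gw sw dw]] := generator t0.
have st : Csq (psi t) by apply: psi_csqint; exact: ltW.
have sl := lap_csqint m cphi.
have siphi := csqintZ mFD 'i%R sphi.
have siw := csqintZ mFD 'i%R sw.
have sil := csqintZ mFD 'i%R sl.
have [w1 w2] := lap_graph_weak gw cphi.
have da := rip_psi_is_derive sphi t0 dw.
have db := rip_psi_is_derive siphi t0 dw.
rewrite (ripNl mFD siw sphi) (ripil mFD sw sphi) opprK w2 in da.
rewrite (ripNl mFD siw siphi) (rip_ii sw sphi) w1 in db.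
have dk : is_derive t 1 (fun s : R => kappa * s) kappa.
  have h : is_derive t 1 (fun s : R => s) (1 : R) by exact: is_derive_id.
  by apply: (is_derive_eq (is_deriveZ kappa h)); rewrite /GRing.scale/= mulr1.
have dc := @is_derive1_comp _ cos (fun s => kappa * s) t _ _ (is_derive_cos _) dk.
have ds := @is_derive1_comp _ sin (fun s => kappa * s) t _ _ (is_derive_sin _) dk.
apply: (is_derive_eq (is_deriveD (is_deriveM dc da) (is_deriveM ds db))).
have -> : Crip (psi t) (fun p => 'i * residual kappa p) =
    Crip (psi t) (fun p => 'i * lap m phi p) + kappa * Crip (psi t) (fun p => 'i * phi p).
  under [X in Crip _ X]eq_fun do rewrite mulrDr mulrCA.
  by rewrite (ripDr mFD sil (csqintZ mFD _ siphi) st) (ripZrr mFD kappa st siphi).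
have -> : Crip (psi t) (residual kappa) =
    Crip (psi t) (lap m phi) + kappa * Crip (psi t) phi.
  by rewrite -(ripZrr mFD kappa st sphi) -(ripDr mFD sl (csqintZ mFD _ sphi) st).
rewrite /GRing.scale/=.
by move: (Crip _ _) (Crip _ _) (Crip _ _) (Crip _ _) (cos _) (sin _) => *; ring.
Qed.

Lemma correlation_lower_bound (kappa t : R) : 0 <= t ->
  Crip phi phi - 2 * (nrm phi * nrm (residual kappa)) * t <= correlation kappa t.
Proof.
move=> t0.
have sl := lap_csqint m cphi.
have sr : Csq (residual kappa) by apply: csqintD => //; exact: csqintZ.
have f0 : correlation kappa 0 = Crip phi phi.
  by rewrite /correlation mulr0 cos0 sin0 mul1r mul0r addr0 psi0_phi.
rewrite -[X in X - _ <= _]f0 lerBlDr -lerBlDl.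
apply: le_trans (ler_norm _) _; rewrite distrC.
apply: (@halfline_growth (correlation kappa)) => //.
  move=> s s0; apply: cvgD; apply: cvgM.
  - apply: cvg_within_filter; apply: (@continuous_comp _ _ _ (fun s => kappa * s) cos).
      by apply: continuousM; [exact: cvg_cst|exact: cvg_id].
    exact: continuous_cos.
  - exact: rip_psi_continuous.
  - apply: cvg_within_filter; apply: (@continuous_comp _ _ _ (fun s => kappa * s) sin).
      by apply: continuousM; [exact: cvg_cst|exact: cvg_id].
    exact: continuous_sin.
  - by apply: rip_psi_continuous => //; exact: csqintZ.
move=> s s0; eexists; first exact: correlation_is_derive.
have ss : Csq (psi s) by apply: psi_csqint; exact: ltW.
have N := mass_phi (ltW s0).
apply: le_trans (ler_normB _ _) _; rewrite !normrM mulr_natl mulr2n.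
have trig (c : R) (x y : R) : `|c| <= 1 -> `|x| <= y -> `|c| * `|x| <= y.
  by move=> c1 xy; rewrite -[y]mul1r ler_pM.
apply: lerD; apply: trig.
- exact: cos_max.
- have := rip_CS mFD ss (csqintZ mFD 'i%R sr).
  by rewrite rip_ii// N.
- exact: sin_max.
- by have := rip_CS mFD ss sr; rewrite N.
Qed.

End Solution.
End Evolution.

(** * Fourier modes in the angular variable *)
Section FourierModes.
Context {R : realType}.
Implicit Types (f g : R * R -> R[i]) (U : R -> R[i]).
Local Notation leb := (@lebesgue_measure R).
Local Notation cyl_measure := (leb \x leb)%E.
Local Notation FD := (@fundamental_domain R).
Local Notation Crip := (rip cyl_measure FD).
Local Notation Csq := (csqint cyl_measure FD).

Definition wave (k : int) U : R * R -> R[i] :=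
  fun p => cexp (0 +i* (k%:~R * p.2)) * U p.1.

Lemma cexp_imaginary (x : R) : cexp (0 +i* x) = cos x +i* sin x.
Proof. by rewrite /cexp /= expR0 mul1r. Qed.

Lemma Re_wave k U p : complex.Re (wave k U p) =
  cos (k%:~R * p.2) * complex.Re (U p.1) - sin (k%:~R * p.2) * complex.Im (U p.1).
Proof. by rewrite /wave cexp_imaginary cReM. Qed.

Lemma Im_wave k U p : complex.Im (wave k U p) =
  cos (k%:~R * p.2) * complex.Im (U p.1) + sin (k%:~R * p.2) * complex.Re (U p.1).
Proof. by rewrite /wave cexp_imaginary cImM. Qed.

Lemma sqint_mul_bounded (c F : R * R -> R) : continuous c ->
  (forall p, `|c p| <= 1) -> sqint cyl_measure FD F ->
  sqint cyl_measure FD (fun p => c p * F p).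
Proof.
move=> cc c1 sF; have mcF : measurable_fun FD (fun p => c p * F p).
  by apply: measurable_funM; [exact: continuous_measurable_FD|exact: sF.1].
apply: integrable_sqint => //.
apply: (integrable_Rle (@measurable_FD R) _ (sqint_integrable sF)).
  exact: measurable_funX.
move=> p _; rewrite normrX normrM exprMn -[leRHS]ger0_norm ?sqr_ge0//.
by rewrite normrX ler_piMl ?exprn_ge0// expr_le1.
Qed.

Lemma continuous_cos_snd (c : R) : continuous (fun p : R * R => cos (c * p.2)).
Proof.
apply: (@continuous_snd _ (fun y => cos (c * y))).
by apply: (@Ck_continuous _ 0); apply: Ck_cos; apply: CkZ; exact: Ck_id.
Qed.

Lemma continuous_sin_snd (c : R) : continuous (fun p : R * R => sin (c * p.2)).
Proof.
apply: (@continuous_snd _ (fun y => sin (c * y))).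
by apply: (@Ck_continuous _ 0); apply: Ck_sin; apply: CkZ; exact: Ck_id.
Qed.

(** The integrand of the Fourier coefficient. *)
Definition demodulated (k : int) f : R * R -> R[i] :=
  fun p => cexp (0 +i* - (k%:~R * p.2)) * f p.

Lemma demodulated_csqint k f : Csq f -> Csq (demodulated k f).
Proof.
move=> [f1 f2].
have cc := @continuous_cos_snd k%:~R; have cs := @continuous_sin_snd k%:~R.
have mFD := @measurable_FD R.
split.
  have -> : (fun p => complex.Re (demodulated k f p)) =
      (fun p => cos (k%:~R * p.2) * complex.Re (f p)
              + sin (k%:~R * p.2) * complex.Im (f p)).
    by apply/funext => p; rewrite /demodulated cexp_imaginary cReM /= cosN sinN; ring.
  by apply: sqintD => //; apply: sqint_mul_bounded => // p; [exact: cos_max|exact: sin_max].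
have -> : (fun p => complex.Im (demodulated k f p)) =
    (fun p => cos (k%:~R * p.2) * complex.Im (f p)
            + -1 * (sin (k%:~R * p.2) * complex.Re (f p))).
  by apply/funext => p; rewrite /demodulated cexp_imaginary cImM /= cosN sinN; ring.
apply: sqintD => //; last apply: sqintZ => //.
  by apply: sqint_mul_bounded => // p; exact: cos_max.
by apply: sqint_mul_bounded => // p; exact: sin_max.
Qed.

(** Circles have finite length, so a square integrable slice is integrable. *)
Lemma sqint_slice (F : R * R -> R) : sqint cyl_measure FD F ->
  {ae leb, forall x : R,
    leb.-integrable `[0, 2 * pi] (EFin \o (fun y => F (x, y)))}.
Proof.
move=> sF; have mFD := @measurable_FD R.
have mF := proj1 (measurable_restrictT _ mFD) sF.1.
have iF := proj1 (@integrable_mkcond _ _ _ cyl_measure _ _ mFD) (sqint_integrable sF).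
have := ae_integrable1 iF; apply: filterS => x iFx.
have pE (G : R * R -> R) y : (G \_ FD) (x, y) = ((fun y => G (x, y)) \_ `[0, 2 * pi]) y.
  rewrite !patchE; congr (if _ then _ else _).
  by apply/idP/idP => /set_mem h; apply: mem_set; [case: h|split].
have mI : measurable (`[0, 2 * pi] : set (g_sigma_algebraType (R.-ocitv.-measurable))).
  exact: measurable_itv.
have mFx : measurable_fun `[0, 2 * pi] (fun y => F (x, y)).
  apply: (proj2 (measurable_restrictT (fun y => F (x, y)) mI)).
  have := measurable_fun_pair2 x mF.
  by congr measurable_fun; apply/funext => y; rewrite pE.
have i2 : leb.-integrable `[0, 2 * pi] (EFin \o (fun y => F (x, y) ^+ 2)).
  apply: (proj2 (@integrable_mkcond _ _ _ leb _ (EFin \o (fun y => F (x, y) ^+ 2)) mI)).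
  move: iFx; congr (integrable _ _ _); apply/funext => y; rewrite !patchE.
  congr (if _ then _ else _).
  by apply/idP/idP => /set_mem h; apply: mem_set; [case: h|split].
have i1 : leb.-integrable `[0, 2 * pi] (EFin \o (fun=> 1 : R)).
  apply: (measurable_bounded_integrable (mu := leb)) => //.
  - by rewrite [X in (X < _)%E]lebesgue_measure_itv/=; case: ifP => _; rewrite ltry.
  - by exists 1; split => // M M1 y _; rewrite /= normr1 ltW.
apply: (integrable_Rle (G := fun y => 1 + F (x, y) ^+ 2) mI mFx).
  exact: (integrable_RD mI i1 i2).
move=> y _ /=; rewrite ler_norml.
have := sqr_ge0 (F (x, y) - 1); have := sqr_ge0 (F (x, y) + 1).
by move: (F _) => z *; apply/andP; split; nra.
Qed.

(** On each circle the pairing with a mode is a Fourier coefficient; almost every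
    circle is needed because [f] is only square integrable. *)
Lemma fourier_coef_inner k U f : Csq f ->
  {ae leb, forall x : R,
    (\int[leb]_(y in `[0%R, (2 * pi)%R])
      (complex.Re (f (x, y)) * complex.Re (wave k U (x, y)) +
       complex.Im (f (x, y)) * complex.Im (wave k U (x, y)))%:E =
     (2 * pi * (complex.Re (fourier_coef f k x) * complex.Re (U x) +
                complex.Im (fourier_coef f k x) * complex.Im (U x)))%:E)%E}.
Proof.
move=> sf; have [s1 s2] := demodulated_csqint k sf.
have mI : measurable (`[0, 2 * pi] : set (g_sigma_algebraType (R.-ocitv.-measurable))).
  exact: measurable_itv.
have := sqint_slice s1; have := sqint_slice s2.
apply: (@filterS2 _ _ (ae_filter_ringOfSetsType leb)) => x i2 i1.
have -> : (fun y => (complex.Re (f (x, y)) * complex.Re (wave k U (x, y)) +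
       complex.Im (f (x, y)) * complex.Im (wave k U (x, y)))%:E) =
   (fun y => (complex.Re (U x) * complex.Re (demodulated k f (x, y)) +
              complex.Im (U x) * complex.Im (demodulated k f (x, y)))%:E).
  apply/funext => y; congr EFin; rewrite Re_wave Im_wave /demodulated cexp_imaginary.
  by rewrite cReM cImM /= cosN sinN; ring.
have iU1 := integrable_RZ mI (complex.Re (U x)) i1.
have iU2 := integrable_RZ mI (complex.Im (U x)) i2.
rewrite integralD_EFin//.
have scaled (c : R) (F : R -> R) : leb.-integrable `[0, 2 * pi] (EFin \o F) ->
    (\int[leb]_(y in `[0%R, (2 * pi)%R]) (c * F y)%:E)%E =
    (c * \int[leb]_(y in `[0, 2 * pi]) F y)%:E.
  move=> iF; rewrite -RintegralZl// /Rintegral fineK//.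
  by apply: (integrable_fin_num mI); exact: integrable_RZ.
rewrite !scaled//.
rewrite -EFinD; congr EFin.
set I1 := Rintegral _ _ _; set I2 := Rintegral _ _ _.
have -> : complex.Re (fourier_coef f k x) = (2 * pi)^-1 * I1.
  by rewrite /fourier_coef cReM [complex.Im (_%:C)]/= mul0r subr0.
have -> : complex.Im (fourier_coef f k x) = (2 * pi)^-1 * I2.
  by rewrite /fourier_coef cImM [complex.Im (_%:C)]/= mul0r addr0.
have pi0 : (pi : R) != 0 by rewrite gt_eqF ?pi_gt0.
by move: I1 I2 (pi : R) pi0 => J1 J2 q q0; field.
Qed.

Lemma rip_iterated f g : Csq f -> Csq g ->
  (Crip f g)%:E = (\int[leb]_x \int[leb]_(y in `[0%R, (2 * pi)%R])
    (complex.Re (f (x, y)) * complex.Re (g (x, y)) +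
     complex.Im (f (x, y)) * complex.Im (g (x, y)))%:E)%E.
Proof.
move=> [f1 f2] [g1 g2]; have mFD := @measurable_FD R.
have i1 := sqintM mFD f1 g1; have i2 := sqintM mFD f2 g2.
rewrite -(FD_integral_iterated (H := fun p => complex.Re (f p) * complex.Re (g p)
  + complex.Im (f p) * complex.Im (g p))); last exact: integrable_RD.
rewrite integralD_EFin// EFinD /rip /ip /Rintegral !fineK//;
  exact: integrable_fin_num.
Qed.

End FourierModes.

Section JapaneseBracketNorms.
Context {R : realType}.
Implicit Types (f g : R * R -> R[i]) (U : R -> R[i]).
Local Notation leb := (@lebesgue_measure R).
Local Notation cyl_measure := (leb \x leb)%E.
Local Notation FD := (@fundamental_domain R).
Local Notation Crip := (rip cyl_measure FD).
Local Notation Csq := (csqint cyl_measure FD).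

Lemma cos_sin_int_period (q : int) (x : R) :
  cos (x + q%:~R * (2 * pi)) = cos x /\ sin (x + q%:~R * (2 * pi)) = sin x.
Proof.
have pos (n : nat) (y : R) : cos (y + n%:R * (2 * pi)) = cos y /\
    sin (y + n%:R * (2 * pi)) = sin y.
  have -> : n%:R * (2 * pi) = pi *+ 2 *+ n :> R.
    by rewrite mulr_natl mulr_natl.
  by split; [exact: (periodicn (@cosD2pi R))|exact: (periodicn (@sinD2pi R))].
case: q => n; first exact: pos.
have := pos n.+1 (x + (Negz n)%:~R * (2 * pi)).
by rewrite NegzE mulrNz mulNr subrK => -[-> ->].
Qed.

Lemma wave_periodic (k : int) U : periodic_theta (wave k U).
Proof.
move=> x y; rewrite /wave /= mulrDr !cexp_imaginary.
by have [-> ->] := cos_sin_int_period k (k%:~R * y).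
Qed.

Lemma Rintegral_trig_period (q : int) (a b : R) : q != 0 ->
  \int[leb]_(y in `[0, 2 * pi]) (a * cos (q%:~R * y) + b * sin (q%:~R * y)) = 0.
Proof.
move=> q0; have qR0 : q%:~R != 0 :> R by rewrite intr_eq0.
have pi0 : (0 : R) < 2 * pi by rewrite mulr_gt0 ?pi_gt0.
pose W (y : R) := q%:~R^-1 * (a * sin (q%:~R * y) - b * cos (q%:~R * y)).
have dW (y : R) : is_derive y 1 W (a * cos (q%:~R * y) + b * sin (q%:~R * y)).
  have dq : is_derive y 1 (fun s : R => q%:~R * s) (q%:~R : R).
    have h : is_derive y 1 (fun s : R => s) (1 : R) by exact: is_derive_id.
    by apply: (is_derive_eq (is_deriveZ q%:~R h)); rewrite /GRing.scale/= mulr1.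
  have dc := @is_derive1_comp _ cos (fun s => q%:~R * s) y _ _ (is_derive_cos _) dq.
  have ds := @is_derive1_comp _ sin (fun s => q%:~R * s) y _ _ (is_derive_sin _) dq.
  apply: (is_derive_eq (is_deriveZ q%:~R^-1 (is_deriveB (is_deriveZ a ds) (is_deriveZ b dc)))).
  rewrite /GRing.scale/=; move: (cos _) (sin _) => C S.
  by move: (q%:~R : R) qR0 => z z0; field.
have cW' : continuous (fun y : R => a * cos (q%:~R * y) + b * sin (q%:~R * y)).
  apply: (@Ck_continuous _ 0); apply: CkD; apply: CkZ.
    by apply: Ck_cos; apply: CkZ; exact: Ck_id.
  by apply: Ck_sin; apply: CkZ; exact: Ck_id.
rewrite /Rintegral (FTC_segment pi0 dW cW') /= /W mulr0.
have [] := cos_sin_int_period q 0; rewrite add0r => -> ->.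
by rewrite subrr.
Qed.

Lemma fourier_coef_wave (k n : int) U x :
  fourier_coef (wave k U) n x = if n == k then U x else 0.
Proof.
have pi0 : (0 : R) < 2 * pi by rewrite mulr_gt0 ?pi_gt0.
have twist y : cexp (0 +i* - (n%:~R * y)) * wave k U (x, y) =
    (complex.Re (U x) * cos ((k - n)%:~R * y)
      + - complex.Im (U x) * sin ((k - n)%:~R * y))
    +i* (complex.Im (U x) * cos ((k - n)%:~R * y)
      + complex.Re (U x) * sin ((k - n)%:~R * y)).
  have -> : (k - n)%:~R * y = k%:~R * y - n%:~R * y :> R by rewrite intrB mulrBl.
  rewrite cexp_imaginary /wave cexp_imaginary /= cosN sinN cosB sinB.
  move: (cos _) (sin _) (cos _) (sin _) => c s c' s'.
  by apply: eqRI; rewrite !cReIm /=; ring.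
rewrite /fourier_coef /cintegral.
under eq_Rintegral do rewrite twist /=.
under [X in _ +i* X]eq_Rintegral do rewrite twist /=.
have [->|nk] := eqVneq n k; last first.
  have kn : k - n != 0 by rewrite subr_eq0 eq_sym.
  by rewrite !Rintegral_trig_period// mulr0.
rewrite subrr.
have cst_int (c d : R) :
    \int[leb]_(y in `[0, 2 * pi]) (c * cos ((0 : int)%:~R * y) + d * sin ((0 : int)%:~R * y))
    = 2 * pi * c.
  under eq_Rintegral do rewrite mul0r cos0 sin0 mulr1 mulr0 addr0.
  rewrite Rintegral_cst; last exact: measurable_itv.
  rewrite [X in fine X]lebesgue_measure_itv/= lte_fin pi0 /= subr0; exact: mulrC.
rewrite !cst_int; apply: eqRI; rewrite cReIm /= mul0r ?subr0 ?addr0.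
  by rewrite mulKf// gt_eqF.
by rewrite mulKf// gt_eqF.
Qed.

Lemma waveZ (c : R) k U :
  wave k (fun x => c%:C * U x) = (fun p => c%:C * wave k U p).
Proof. by apply/funext => p; rewrite /wave mulrCA. Qed.

Lemma rip_real_scale (c : R) f : Csq f ->
  Crip (fun p => c%:C * f p) (fun p => c%:C * f p) = c ^+ 2 * Crip f f.
Proof.
move=> sf; have mFD := @measurable_FD R; have scf := csqintZ mFD c%:C sf.
by rewrite (ripZrl mFD c sf scf) (ripZrr mFD c sf sf) mulrA expr2.
Qed.

(** A mode is an eigenfunction of the multiplier, so a multiple of it competes in
    the infimum. *)
Lemma japD_sqnorm_wave_le (r : R) k U : Csq (wave k U) ->
  (japD_sqnorm r (wave k U) <=
   (((jap k%:~R) `^ r) ^+ 2 * Crip (wave k U) (wave k U))%:E)%E.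
Proof.
move=> sw; have mFD := @measurable_FD R; set c := (jap _) `^ r.
have scw := csqintZ mFD c%:C sw.
rewrite -rip_real_scale// -sqnorm_rip//; apply: ereal_inf_lbound.
exists (fun p => c%:C * wave k U p) => //; split.
  apply: L2_of_csqint => // x y; rewrite wave_periodic//.
move=> n; apply: aeW => x; rewrite -waveZ !fourier_coef_wave.
by case: eqP => [->|_]; rewrite ?mulr0.
Qed.

(** Where the profile [U] lives the cut-off is inactive, so it does not alter
    the pairing with the mode [k]. *)
Lemma japD_rip (r : R) k U (chi : R -> R[i]) f g : 
  Csq (wave k U) -> Csq f -> (forall x, U x != 0 -> chi x = 1) ->
  is_japD r (fun p => chi p.1 * f p) g ->
  Crip g (wave k U) = (jap k%:~R) `^ r * Crip f (wave k U).
Proof.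
move=> sw sf chi1 [/L2_csqint sg gf]; have mFD := @measurable_FD R.
set c := (jap _) `^ r.
have scw : Csq (wave k (fun x => c%:C * U x)) by rewrite waveZ; exact: csqintZ.
rewrite -(ripZrr mFD c sf sw) -waveZ; apply: EFin_inj.
rewrite (rip_iterated sg sw) (rip_iterated sf scw).
have mF f1 f2 : Csq f1 -> Csq f2 -> measurable_fun [set: g_sigma_algebraType (R.-ocitv.-measurable)]
    (fun x => \int[leb]_(y in `[0%R, (2 * pi)%R])
    (complex.Re (f1 (x, y)) * complex.Re (f2 (x, y)) +
     complex.Im (f1 (x, y)) * complex.Im (f2 (x, y)))%:E)%E.
  move=> [f11 f12] [f21 f22].
  have iH := integrable_RD mFD (sqintM mFD f11 f21) (sqintM mFD f12 f22).
  have := measurable_fubini_F (proj1 (@integrable_mkcond _ _ _ cyl_measure _ _ mFD) iH).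
  congr measurable_fun; apply/funext => x; rewrite /fubini_F [RHS]integral_mkcond.
  apply: eq_integral => y _; rewrite !patchE; congr (if _ then _ else _).
  by apply/idP/idP => /set_mem h; apply: mem_set; [case: h|split].
apply: (ae_eq_integral _ _ measurableT (mF _ _ sg sw) (mF _ _ sf scw)).
have := fourier_coef_inner k U sg; have := fourier_coef_inner k (fun x => c%:C * U x) sf.
apply: (@filterS3 _ _ (ae_filter_ringOfSetsType leb)) (gf k) => x gx fx hx _.
rewrite hx fx gx -/c; cbv beta; congr EFin; congr (_ * _).
rewrite [complex.Re (_ * U x)]cReM [complex.Im (_ * U x)]cImM.
have [U0|/chi1 chix] := eqVneq (U x) 0.
  have [-> ->] : complex.Re (U x) = 0 /\ complex.Im (U x) = 0 by rewrite U0.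
  by rewrite !mulr0 subr0 !addr0 !mulr0 addr0.
have -> : fourier_coef (fun p => chi p.1 * f p) k x = fourier_coef f k x.
  rewrite /fourier_coef; congr (_ * cintegral _ _); apply/funext => y /=.
  by rewrite chix mul1r.
move: (fourier_coef f k x) => z; rewrite cReM cImM.
by rewrite [complex.Re _%:C]/= [complex.Im _%:C]/=; ring.
Qed.

End JapaneseBracketNorms.

(** * The quasimode as a rescaled fixed profile *)
Section ComplexSmoothFunctions.
Context {R : realType}.
Implicit Types (f g : R -> R[i]) (z : R[i]).

Definition cCinf f : Prop :=
  Cinf (fun x => complex.Re (f x)) /\ Cinf (fun x => complex.Im (f x)).

Lemma cCinfM f g : cCinf f -> cCinf g -> cCinf (fun x => f x * g x).
Proof.
move=> [f1 f2] [g1 g2]; split=> n.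
  by under eq_fun do rewrite cReM; apply: CkB; apply: CkM.
by under eq_fun do rewrite cImM; apply: CkD; apply: CkM.
Qed.

Lemma ReV z : complex.Re z^-1 = complex.Re z / abs2 z.
Proof. by case: z. Qed.

Lemma ImV z : complex.Im z^-1 = - (complex.Im z / abs2 z).
Proof. by case: z. Qed.

Lemma abs2_gt0 z : z != 0 -> 0 < abs2 z.
Proof.
move=> z0; rewrite lt_neqAle abs2_ge0 andbT eq_sym; apply: contra z0.
rewrite /abs2 paddr_eq0 ?sqr_ge0// !sqrf_eq0 => /andP[/eqP z1 /eqP z2].
by apply/eqP/eqRI.
Qed.

Lemma cCinfV f : (forall x, f x != 0) -> cCinf f -> cCinf (fun x => (f x)^-1).
Proof.
move=> f0 [f1 f2].
have fV n : Ck n (fun x => (abs2 (f x))^-1).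
  by apply: CkV; [move=> x; rewrite gt_eqF// abs2_gt0|apply: CkD; exact: CkX].
split=> n.
  by under eq_fun do rewrite ReV; exact: CkM.
by under eq_fun do rewrite ImV; apply: CkN; exact: CkM.
Qed.

Lemma cCinf_cexp f : cCinf f -> cCinf (fun x => cexp (f x)).
Proof.
move=> [f1 f2]; rewrite /cexp; split=> n.
  under eq_fun do rewrite cReM /= mul0r subr0.
  by apply: CkM; [exact: Ck_exp|exact: Ck_cos].
under eq_fun do rewrite cImM /= mul0r addr0.
by apply: CkM; [exact: Ck_exp|exact: Ck_sin].
Qed.

(** On the upper half-plane the sign in the definition of the principal root is
    constant. *)
Lemma sqrtc_upper z : 0 < complex.Im z ->
  let r := Num.sqrt (abs2 z) in
  sqrtc z = Num.sqrt ((r + complex.Re z) / 2) +i* Num.sqrt ((r - complex.Re z) / 2).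
Proof. by case: z => a b /= b0; rewrite gt_eqF// gtr0_sg// mul1r. Qed.

Lemma abs_Re_lt_modulus z : 0 < complex.Im z ->
  `|complex.Re z| < Num.sqrt (abs2 z).
Proof.
move=> z0; rewrite -sqrtr_sqr ltr_sqrt ?ltrDl ?exprn_gt0//.
by rewrite ltr_wpDl ?sqr_ge0 ?exprn_gt0.
Qed.

Lemma cCinf_sqrtc f : (forall x, 0 < complex.Im (f x)) -> cCinf f ->
  cCinf (fun x => sqrtc (f x)).
Proof.
move=> f0 [f1 f2].
have a0 x : 0 < abs2 (f x) by rewrite ltr_wpDl ?sqr_ge0 ?exprn_gt0.
have rC n : Ck n (fun x => Num.sqrt (abs2 (f x))).
  by apply: Ck_sqrt => //; apply: CkD; exact: CkX.
have := fun x => abs_Re_lt_modulus (f0 x) => rf.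
split=> n.
  under eq_fun do rewrite sqrtc_upper//= mulrC.
  apply: Ck_sqrt => [x|]; last by apply: CkZ; exact: CkD.
  by have := rf x; rewrite ltr_norml => /andP[? _]; rewrite mulr_gt0//; lra.
under eq_fun do rewrite sqrtc_upper//= mulrC.
apply: Ck_sqrt => [x|]; last by apply: CkZ; exact: CkB.
by have := rf x; rewrite ltr_norml => /andP[_ ?]; rewrite mulr_gt0//; lra.
Qed.

Lemma sqrtc_scale (c : R) z : 0 < c -> 0 < complex.Im z ->
  sqrtc ((c ^+ 2)%:C * z) = c%:C * sqrtc z.
Proof.
move=> c0 z0; have c20 : 0 < c ^+ 2 by rewrite exprn_gt0.
have z0' : 0 < complex.Im ((c ^+ 2)%:C * z).
  by rewrite cImM /= mul0r addr0 mulr_gt0.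
rewrite !sqrtc_upper//= abs2M.
have -> : abs2 (c ^+ 2)%:C = (c ^+ 2) ^+ 2 :> R by rewrite /abs2 /= expr0n addr0.
have -> : Num.sqrt ((c ^+ 2) ^+ 2 * abs2 z) = c ^+ 2 * Num.sqrt (abs2 z).
  by rewrite sqrtrM ?sqr_ge0// sqrtr_sqr (gtr0_norm c20).
rewrite cReM /= mul0r subr0.
have s x : Num.sqrt (c ^+ 2 * x) = c * Num.sqrt x.
  by rewrite sqrtrM ?sqr_ge0// sqrtr_sqr gtr0_norm.
have -> (x y : R) : (c ^+ 2 * x + c ^+ 2 * y) / 2 = c ^+ 2 * ((x + y) / 2).
  by rewrite -mulrDr mulrA.
have -> (x y : R) : (c ^+ 2 * x - c ^+ 2 * y) / 2 = c ^+ 2 * ((x - y) / 2).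
  by rewrite -mulrBr mulrA.
rewrite !s.
by apply: eqRI; rewrite ?cReM ?cImM /= mul0r ?subr0 ?addr0.
Qed.

End ComplexSmoothFunctions.

Section IntegralFromTo.
Context {R : realType}.
Local Notation leb := (@lebesgue_measure R).

Definition integral_from_to (f : R -> R) (x : R) : R :=
  if 0 <= x then \int[leb]_(y in `[0, x]) f y else - \int[leb]_(y in `[x, 0]) f y.

Lemma integral_from_to0 f : integral_from_to f 0 = 0.
Proof. by rewrite /integral_from_to lexx set_itv1 Rintegral_set1. Qed.

Lemma continuous_integrable (f : R -> R) (a b : R) : continuous f ->
  leb.-integrable `[a, b] (EFin \o f).
Proof.
move=> cf; apply: continuous_compact_integrable; first exact: segment_compact.
exact: continuous_subspaceT.
Qed.

Lemma Rintegral_split (f : R -> R) (a b c : R) : continuous f -> a <= b -> b <= c ->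
  \int[leb]_(y in `[a, c]) f y =
  \int[leb]_(y in `[a, b]) f y + \int[leb]_(y in `[b, c]) f y.
Proof.
move=> cf ab bc; rewrite -[X in _ + X]Rintegral_itv_obnd_cbnd; last first.
  apply: integrableS (continuous_integrable b c cf) => //; apply: subset_itvr.
  by rewrite bnd_simp.
rewrite -(@Rintegral_itvB _ f (BLeft a) (BRight c) b)//.
- by rewrite addrC subrK.
- exact: continuous_integrable.
Qed.

(** Near [x], the signed integral from [0] is the difference of two integrals
    from a common left end point [a], to which the fundamental theorem applies. *)
Lemma integral_from_to_is_derive (f : R -> R) (x : R) : continuous f ->
  is_derive x 1 (integral_from_to f) (f x).
Proof.
move=> cf; pose a := - (`|x| + 1).
have ax : a < x.
  by have := ler_norm (- x); rewrite normrN /a => *; lra.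
have a0 : a < 0 by rewrite /a oppr_lt0 ltr_wpDl.
pose P (y : R) := \int[leb]_(t in `[a, y]) f t.
have [dP P'] : derivable P x 1 /\ derive1 P x = f x.
  apply: (@continuous_FTC1_closed _ f a x (x + 1)) => //; last exact: cf.
    by rewrite ltrDl.
  exact: continuous_integrable.
apply: (@near_eq_is_derive _ _ _ (fun y => P y - P 0)).
  have : nbhs x [set y | a < y] by apply: open_nbhs_nbhs; split => //; exact: open_gt.
  apply: filterS => y /= ay; rewrite /integral_from_to /P; case: ifPn => y0.
    by rewrite (Rintegral_split cf (ltW a0) y0) addrC addKr.
  rewrite -ltNge in y0.
  by rewrite [X in _ - X](Rintegral_split cf (ltW ay) (ltW y0)) opprD addrA subrr add0r.
have h : is_derive x 1 P (f x) by rewrite -P' derive1E; exact: derivableP.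
by apply: (is_derive_eq (is_deriveB h (is_derive_cst (P 0) x 1))); rewrite subr0.
Qed.

Lemma cintegral_from_toE (f : R -> R[i]) (x : R) :
  cintegral_from_to 0 x f =
  integral_from_to (fun y => complex.Re (f y)) x
  +i* integral_from_to (fun y => complex.Im (f y)) x.
Proof. by rewrite /cintegral_from_to /integral_from_to; case: ifP. Qed.

End IntegralFromTo.

Section QuasimodeProfile.
Context {R : realType}.
Variables (m : nat) (alpha beta : R).
Hypothesis beta_gt0 : 0 < beta.

(** The derivative of the phase, the phase and the quasimode for [h = 1]. *)
Definition unit_symbol (s : R) : R[i] :=
  sqrtc ((alpha +i* beta) + (m%:R^-1 * s ^+ (2 * m))%:C).

Definition unit_phase (s : R) : R[i] :=
  integral_from_to (fun y => complex.Re (unit_symbol y)) s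
  +i* integral_from_to (fun y => complex.Im (unit_symbol y)) s.

Definition profile (chi0 : R -> R[i]) (s : R) : R[i] :=
  chi0 s * ((sqrtc (unit_symbol s))^-1 * cexp ('i * unit_phase s)).

Lemma cCinf_symbol (z : R[i]) : 0 < complex.Im z ->
  cCinf (fun s : R => sqrtc (z + (m%:R^-1 * s ^+ (2 * m))%:C)).
Proof.
move=> z0; apply: cCinf_sqrtc => [s|]; first by rewrite cImD /= addr0.
split=> n.
  under eq_fun do rewrite cReD /=.
  by apply: CkD; [exact: Ck_cst|apply: CkZ; apply: CkX; exact: Ck_id].
under eq_fun do rewrite cImD /=.
exact: Ck_cst.
Qed.

Lemma Im_unit_symbol_gt0 s : 0 < complex.Im (unit_symbol s).
Proof. by apply: Im_sqrtc_gt0; rewrite cImD /= addr0. Qed.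

Lemma cCinf_unit_symbol : cCinf unit_symbol.
Proof. exact: cCinf_symbol. Qed.

Lemma sqrtc_unit_symbol_neq0 s : sqrtc (unit_symbol s) != 0.
Proof.
apply/eqP => s0.
by have := Im_sqrtc_gt0 (Im_unit_symbol_gt0 s); rewrite s0 ltxx.
Qed.

Lemma Cinf_integral_from_to (f : R -> R) : Cinf f -> Cinf (integral_from_to f).
Proof.
move=> fC n; apply: CkW; apply: Ck_is_derive (fC n) => x.
by apply: integral_from_to_is_derive; exact: (Ck_continuous (fC 0%N)).
Qed.

Lemma cCinf_profile chi0 : Cc_infty chi0 -> cCinf (profile chi0).
Proof.
move=> [/smooth1_Cinf c1 /smooth1_Cinf c2 _].
have [w1 w2] := cCinf_unit_symbol.
apply: cCinfM => //; apply: cCinfM.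
  apply: cCinfV; first exact: sqrtc_unit_symbol_neq0.
  by apply: cCinf_sqrtc => //; exact: Im_unit_symbol_gt0.
apply: cCinf_cexp; apply: cCinfM.
  by split=> n; exact: Ck_cst.
by split; exact: Cinf_integral_from_to.
Qed.

Lemma profile_supported chi0 s : supp chi0 `<=` `[-2, 2] -> 2 < `|s| ->
  profile chi0 s = 0.
Proof.
move=> c2 s2; rewrite /profile; have [->|c0] := eqVneq (chi0 s) 0.
  by rewrite mul0r.
have /c2 : supp chi0 s by apply: subset_closure.
by rewrite /= in_itv/= -ler_norml leNgt s2.
Qed.

Lemma cexp_neq0 (z : R[i]) : cexp z != 0.
Proof.
apply/eqP => z0; have : abs2 (cexp z) = 0 by rewrite z0 /abs2 /= expr0n addr0.
rewrite abs2M /abs2 /= expr0n addr0 cos2Dsin2 mulr1 => /eqP.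
by rewrite expf_eq0 /= gt_eqF ?expR_gt0.
Qed.

Lemma profile0_neq0 chi0 : chi0 0 = 1 -> profile chi0 0 != 0.
Proof.
move=> c1; rewrite /profile c1 mul1r mulf_neq0 ?cexp_neq0//.
by rewrite invr_eq0 sqrtc_unit_symbol_neq0.
Qed.

Section Scaling.
Variable h : R.
Hypothesis h_gt0 : 0 < h.

Let gamma := h `^ (m.+1%:R^-1).
Let gamma_gt0 : 0 < gamma. Proof. exact: powR_gt0. Qed.

Lemma gamma_expS : gamma ^+ m.+1 = h.
Proof.
by rewrite -powR_mulrn ?ltW// /gamma -powRrM mulVf ?powRr1 ?ltW.
Qed.

Let symbol (y : R) : R[i] :=
  sqrtc (energy m alpha beta h + (m%:R^-1 * y ^+ (2 * m))%:C).

Lemma energy_gamma : energy m alpha beta h = ((gamma ^+ m) ^+ 2)%:C * (alpha +i* beta).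
Proof.
rewrite /energy mulrC; congr (_%:C * _).
by rewrite mulrC powRrM -/gamma powR_mulrn ?ltW// mulnC exprM.
Qed.

Lemma symbol_scaling s : symbol (gamma * s) = (gamma ^+ m)%:C * unit_symbol s.
Proof.
rewrite /symbol /unit_symbol -sqrtc_scale ?exprn_gt0//; last by rewrite cImD /= addr0.
congr sqrtc; rewrite energy_gamma mulrDr; congr (_ + _).
rewrite -rmorphM; congr (_%:C).
by rewrite exprMn (mulnC 2%N) !exprM; ring.
Qed.

Lemma cCinf_energy_symbol : cCinf symbol.
Proof.
apply: cCinf_symbol; rewrite energy_gamma cImM /= mul0r addr0.
by rewrite mulr_gt0// !exprn_gt0.
Qed.

Lemma cderive_varpi x : cderive (varpi m alpha beta h) x = symbol x.
Proof.
have [s1 s2] := cCinf_energy_symbol.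
have vE : varpi m alpha beta h = (fun x =>
    integral_from_to (fun y => complex.Re (symbol y)) x
    +i* integral_from_to (fun y => complex.Im (symbol y)) x).
  by apply/funext => y; rewrite /varpi cintegral_from_toE.
rewrite /cderive vE /= !derive1E.
have [_ ->] := integral_from_to_is_derive x (Ck_continuous (s1 0%N)).
have [_ ->] := integral_from_to_is_derive x (Ck_continuous (s2 0%N)).
exact/esym/eqRI.
Qed.

(** Both sides are antiderivatives of the same function. *)
Lemma integral_from_to_scaling (f g : R -> R) s : continuous f -> continuous g ->
  (forall y, f (gamma * y) = gamma ^+ m * g y) ->
  integral_from_to f (gamma * s) = h * integral_from_to g s.
Proof.
move=> cf cg fg.
pose W y := integral_from_to f (gamma * y) - h * integral_from_to g y.
suff : W s = W 0.
  rewrite /W mulr0 !integral_from_to0 mulr0 subr0 => /eqP.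
  by rewrite subr_eq0 => /eqP.
apply: is_derive_0_is_cst => y.
have dg : is_derive y 1 (fun s : R => gamma * s) gamma.
  have d1 : is_derive y 1 (fun s : R => s) (1 : R) by exact: is_derive_id.
  by apply: (is_derive_eq (is_deriveZ gamma d1)); rewrite /GRing.scale/= mulr1.
have d1 := @is_derive1_comp _ (integral_from_to f) (fun s => gamma * s) y _ _
  (integral_from_to_is_derive (gamma * y) cf) dg.
have d2 := is_deriveZ h (integral_from_to_is_derive y cg).
apply: (is_derive_eq (is_deriveB d1 d2)).
by rewrite fg /GRing.scale/= -gamma_expS exprS; ring.
Qed.

Lemma varpi_scaling s : varpi m alpha beta h (gamma * s) = h%:C * unit_phase s.
Proof.
have [s1 s2] := cCinf_energy_symbol; have [u1 u2] := cCinf_unit_symbol.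
rewrite /varpi cintegral_from_toE.
rewrite (@integral_from_to_scaling _ (fun y => complex.Re (unit_symbol y)))//; last 3 first.
- exact: (Ck_continuous (s1 0%N)).
- exact: (Ck_continuous (u1 0%N)).
- by move=> y; rewrite -/(symbol _) symbol_scaling cReM /= mul0r subr0.
rewrite (@integral_from_to_scaling _ (fun y => complex.Im (unit_symbol y)))//; last 3 first.
- exact: (Ck_continuous (s2 0%N)).
- exact: (Ck_continuous (u2 0%N)).
- by move=> y; rewrite -/(symbol _) symbol_scaling cImM /= mul0r addr0.
by apply: eqRI; rewrite ?cReM ?cImM /= mul0r ?subr0 ?addr0.
Qed.

(** The equation [gamma ^ (m + 1) = h] makes the phase exactly homogeneous, so
    the truncated quasimode is a dilation of one fixed profile. *)
Lemma quasi_utilde_scaling chi0 x :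
  quasi_utilde m alpha beta h chi0 x =
  (Num.sqrt (gamma ^+ m))^-1%:C * profile chi0 (x / gamma).
Proof.
have g0 : gamma != 0 by rewrite gt_eqF.
have h0 : h%:C != 0 :> R[i] by rewrite eq_complex /= eqxx andbT gt_eqF.
rewrite /quasi_utilde -/gamma; set s := x / gamma.
have -> : x = gamma * s by rewrite /s mulrC divfK.
rewrite /quasi_u cderive_varpi symbol_scaling varpi_scaling.
have gm0 : 0 < gamma ^+ m by rewrite exprn_gt0.
rewrite -{1}(sqr_sqrtr (ltW gm0)) sqrtc_scale ?sqrtr_gt0 ?Im_unit_symbol_gt0//.
have -> : 'i * (h%:C * unit_phase s) / h%:C = 'i * unit_phase s.
  by rewrite mulrCA mulrAC mulfV// mul1r.
rewrite /profile invfM -mulrA mulrCA; congr (_ * _).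
by rewrite fmorphV.
Qed.

End Scaling.
End QuasimodeProfile.

(** * The residual of the initial datum *)
Section WaveResidual.
Context {R : realType}.
Variable m : nat.
Implicit Types (U v : R -> R[i]).
Local Notation leb := (@lebesgue_measure R).
Local Notation cyl_measure := (leb \x leb)%E.
Local Notation FD := (@fundamental_domain R).
Local Notation Crip := (rip cyl_measure FD).
Local Notation Csq := (csqint cyl_measure FD).

Lemma Ck_trig n (c : R) :
  Ck n (fun y : R => cos (c * y)) /\ Ck n (fun y : R => sin (c * y)).
Proof. by split; [apply: Ck_cos|apply: Ck_sin]; apply: CkZ; exact: Ck_id. Qed.

Lemma Cn_wave n k U : cCinf U ->
  Cn n (fun p => complex.Re (wave k U p)) /\ Cn n (fun p => complex.Im (wave k U p)).
Proof.
move=> [u1 u2]; have [cC cS] := Ck_trig n k%:~R; split.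
  have -> : (fun p => complex.Re (wave k U p)) =
    (fun p => complex.Re (U p.1) * cos (k%:~R * p.2)
            + - complex.Im (U p.1) * sin (k%:~R * p.2)).
    by apply/funext => p; rewrite Re_wave; ring.
  apply: CnD; first exact: (Cn_tensor (u1 n) cC).
  exact: (Cn_tensor (CkN (u2 n)) cS).
have -> : (fun p => complex.Im (wave k U p)) =
  (fun p => complex.Im (U p.1) * cos (k%:~R * p.2)
          + complex.Re (U p.1) * sin (k%:~R * p.2)).
  by apply/funext => p; rewrite Im_wave; ring.
by apply: CnD; [exact: (Cn_tensor (u2 n) cC)|exact: (Cn_tensor (u1 n) cS)].
Qed.

Lemma Cc_infty_cyl_wave (a : R) k U : cCinf U -> (forall x, a < `|x| -> U x = 0) ->
  Cc_infty_cyl (wave k U).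
Proof.
move=> UC U0; split; first exact: wave_periodic.
- by move=> n; have [] := Cn_wave n k UC.
- by move=> n; have [] := Cn_wave n k UC.
- by exists a => p ap; rewrite /wave U0// mulr0.
Qed.

Definition cderive2 U (x : R) : R[i] :=
  derive1 (derive1 (fun y => complex.Re (U y))) x
  +i* derive1 (derive1 (fun y => complex.Im (U y))) x.

Definition profile_residual (k : int) U (x : R) : R[i] :=
  cderive2 U x + (k%:~R ^+ 2 * (1 - Afun m x ^- 2) - V1 m x)%:C * U x.

Lemma is_derive_trig (a b c y : R) :
  is_derive y 1 (fun y => a * cos (c * y) + b * sin (c * y))
    (c * b * cos (c * y) + - (c * a) * sin (c * y)).
Proof.
have dq : is_derive y 1 (fun s : R => c * s) c.
  have h : is_derive y 1 (fun s : R => s) (1 : R) by exact: is_derive_id.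
  by apply: (is_derive_eq (is_deriveZ c h)); rewrite /GRing.scale/= mulr1.
have dc := @is_derive1_comp _ cos (fun s => c * s) y _ _ (is_derive_cos _) dq.
have ds := @is_derive1_comp _ sin (fun s => c * s) y _ _ (is_derive_sin _) dq.
apply: (is_derive_eq (is_deriveD (is_deriveZ a dc) (is_deriveZ b ds))).
by rewrite /GRing.scale/=; ring.
Qed.

(** Two angular derivatives multiply a mode by [- c ^ 2]. *)
Lemma rlap_mode (f g : R -> R) (c : R) : Cinf f -> Cinf g ->
  rlap m (fun p => f p.1 * cos (c * p.2) + g p.1 * sin (c * p.2)) =
  (fun p => (derive1 (derive1 f) p.1 * cos (c * p.2)
             + derive1 (derive1 g) p.1 * sin (c * p.2))
     - (c ^+ 2 * Afun m p.1 ^- 2 + V1 m p.1)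
       * (f p.1 * cos (c * p.2) + g p.1 * sin (c * p.2))).
Proof.
move=> fC gC.
have dx (u w : R -> R) : Cinf u -> Cinf w ->
    pdx (fun p => u p.1 * cos (c * p.2) + w p.1 * sin (c * p.2)) =
    (fun p => derive1 u p.1 * cos (c * p.2) + derive1 w p.1 * sin (c * p.2)).
  move=> uC wC; apply: pdx_eq => x y /=.
  have [df _] := CkS (uC 1%N); have [dg _] := CkS (wC 1%N).
  apply: (is_derive_eq (is_deriveD (is_deriveM (df x) (is_derive_cst (cos (c * y)) x 1))
     (is_deriveM (dg x) (is_derive_cst (sin (c * y)) x 1)))).
  by rewrite /GRing.scale/=; move: (cos _) (sin _) (derive1 _ _) (derive1 _ _) => *; ring.
have dy (u w : R -> R) :
    pdtheta (fun p => u p.1 * cos (c * p.2) + w p.1 * sin (c * p.2)) =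
    (fun p => c * w p.1 * cos (c * p.2) + - (c * u p.1) * sin (c * p.2)).
  by apply: pdtheta_eq => x y /=; exact: is_derive_trig.
have f'C : Cinf (derive1 f) by move=> n; have [] := CkS (fC n.+1).
have g'C : Cinf (derive1 g) by move=> n; have [] := CkS (gC n.+1).
apply/funext => p; rewrite /rlap dx// dx// (dy f g).
rewrite (dy (fun x => c * g x) (fun x => - (c * f x))) /=.
by move: (cos _) (sin _) (derive1 _ _) (derive1 _ _) (Afun _ _) (V1 _ _) => *; ring.
Qed.

Lemma Cinf_N (f : R -> R) : Cinf f -> Cinf (fun x => - f x).
Proof. by move=> fC n; exact: CkN. Qed.

Lemma derive2N (f : R -> R) x : Cinf f ->
  derive1 (derive1 (fun x => - f x)) x = - derive1 (derive1 f) x.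
Proof.
move=> fC; have [df f'] := CkS (fC 2%N); have [df' _] := CkS f'.
have dN (g g' : R -> R) : (forall x : R, is_derive x 1 g (g' x)) ->
    derive1 (fun x => - g x) = (fun x => - g' x).
  by move=> dg; apply: is_derive_derive1 => y; exact: is_deriveN.
by rewrite (dN _ _ df) (dN _ _ df').
Qed.

(** The coefficients of [lap] depend on [x] only, so [lap] preserves the modes. *)
Lemma residual_wave k U : cCinf U ->
  residual m (wave k U) (k%:~R ^+ 2) = wave k (profile_residual k U).
Proof.
move=> [u1 u2]; apply/funext => p; rewrite /residual.
apply: eqRI.
  rewrite cReD Re_lap cReM /= mul0r subr0.
  have E : (fun q => complex.Re (wave k U q)) =
    (fun q => complex.Re (U q.1) * cos (k%:~R * q.2)
            + - complex.Im (U q.1) * sin (k%:~R * q.2)).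
    by apply/funext => q; rewrite Re_wave; ring.
  rewrite E (rlap_mode _ u1 (Cinf_N u2)) derive2N// !Re_wave.
  rewrite /profile_residual cReD cImD cReM cImM /=.
  by move: (cos _) (sin _) (derive1 _ _) (derive1 _ _) (Afun _ _) (V1 _ _) => *; ring.
rewrite cImD Im_lap cImM /= mul0r addr0.
have E : (fun q => complex.Im (wave k U q)) =
  (fun q => complex.Im (U q.1) * cos (k%:~R * q.2)
          + complex.Re (U q.1) * sin (k%:~R * q.2)).
  by apply/funext => q; rewrite Im_wave; ring.
rewrite E (rlap_mode _ u2 u1) !Im_wave.
rewrite /profile_residual cReD cImD cReM cImM /=.
by move: (cos _) (sin _) (derive1 _ _) (derive1 _ _) (Afun _ _) (V1 _ _) => *; ring.
Qed.

Lemma abs2_wave k U p : abs2 (wave k U p) = abs2 (U p.1).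
Proof. by rewrite /wave abs2M cexp_imaginary /abs2 /= cos2Dsin2 mul1r. Qed.

Lemma rip_wave k U : Csq (wave k U) ->
  Crip (wave k U) (wave k U) = \int[cyl_measure]_(p in FD) abs2 (U p.1).
Proof.
move=> sw; have := sqnorm_rip sw; rewrite /sqnorm => /(congr1 fine) /= <-.
by congr fine; apply: eq_integral => p _; rewrite abs2_wave.
Qed.

Lemma integrable_abs2_wave k U : Csq (wave k U) ->
  cyl_measure.-integrable FD (EFin \o (fun p => abs2 (U p.1))).
Proof.
move=> [s1 s2]; have mFD := @measurable_FD R.
have := integrable_RD mFD (sqint_integrable s1) (sqint_integrable s2).
congr (integrable _ _ _); apply/funext => p /=; congr EFin.
exact: (abs2_wave k U p).
Qed.

Lemma rip_wave_le (a K : R) k U : 0 <= a -> Csq (wave k U) ->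
  (forall x, `|x| <= a -> abs2 (U x) <= K) -> (forall x, a < `|x| -> U x = 0) ->
  Crip (wave k U) (wave k U) <= K * (2 * a * (2 * pi)).
Proof.
move=> a0 sw UK U0; rewrite rip_wave// -Rintegral_box//.
have mFD := @measurable_FD R.
apply: le_Rintegral => //; [exact: integrable_abs2_wave sw|exact: integrable_box|].
move=> p [_ p2]; rewrite indicE.
have [ap|pa] := ltP a `|p.1|.
  rewrite U0// memNset ?mulr0; first by rewrite /abs2 /= expr0n addr0.
  by move=> [/=]; rewrite in_itv/= -ler_norml leNgt ap.
by rewrite mem_set ?mulr1 ?UK//; split => //=; rewrite in_itv/= -ler_norml.
Qed.

Lemma rip_wave_ge (a K : R) k U : 0 <= a -> Csq (wave k U) ->
  (forall x, `|x| <= a -> K <= abs2 (U x)) ->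
  K * (2 * a * (2 * pi)) <= Crip (wave k U) (wave k U).
Proof.
move=> a0 sw UK; rewrite rip_wave// -Rintegral_box//.
have mFD := @measurable_FD R.
apply: le_Rintegral => //; [exact: integrable_box|exact: integrable_abs2_wave sw|].
move=> p [_ p2]; rewrite indicE.
have [ap|pa] := ltP a `|p.1|.
  rewrite memNset ?mulr0 ?abs2_ge0//.
  by move=> [/=]; rewrite in_itv/= -ler_norml leNgt ap.
by rewrite mem_set ?mulr1 ?UK//; split => //=; rewrite in_itv/= -ler_norml.
Qed.

Lemma continuous_bounded_interval (f : R -> R) (a : R) : continuous f ->
  exists2 K, 0 <= K & forall x, `|x| <= a -> `|f x| <= K.
Proof.
move=> cf; have [K K0 fK] := continuous_bounded_box a (continuous_fst cf).
exists K => // x xa; apply: (fK (x, 0)); split; rewrite /= in_itv/=.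
  by rewrite -ler_norml.
by rewrite lexx twopi_ge0.
Qed.

End WaveResidual.

Section ResidualBound.
Context {R : realType}.
Variable m : nat.
Hypothesis m_gt0 : (0 < m)%N.
Local Notation leb := (@lebesgue_measure R).
Local Notation cyl_measure := (leb \x leb)%E.
Local Notation FD := (@fundamental_domain R).
Local Notation Crip := (rip cyl_measure FD).
Local Notation Csq := (csqint cyl_measure FD).
Local Notation nrm f := (Num.sqrt (Crip f f)).

Variable v : R -> R[i].
Hypothesis vC : cCinf v.
Hypothesis v_supp : forall s, 2 < `|s| -> v s = 0.
Hypothesis v0 : v 0 != 0.

Definition dilation (c gamma : R) (x : R) : R[i] := c%:C * v (x / gamma).

Lemma derive2_dilation (f : R -> R) (c d x : R) : Cinf f ->
  derive1 (derive1 (fun x => c * f (x * d))) x = c * d ^+ 2 * derive1 (derive1 f) (x * d).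
Proof.
move=> fC; have [df f'] := CkS (fC 2%N); have [df' _] := CkS f'.
have step (g g' : R -> R) (e : R) : (forall x : R, is_derive x 1 g (g' x)) ->
    derive1 (fun x => e * g (x * d)) = (fun x => e * d * g' (x * d)).
  move=> dg; apply: is_derive_derive1 => y.
  have dl : is_derive y 1 (fun s : R => s * d) d.
    have h : is_derive y 1 (fun s : R => s) (1 : R) by exact: is_derive_id.
    apply: (is_derive_eq (is_deriveM h (is_derive_cst d y 1))).
    by rewrite /GRing.scale/= mulr0 add0r mulr1.
  have dgl := @is_derive1_comp _ g (fun s => s * d) y _ _ (dg (y * d)) dl.
  by apply: (is_derive_eq (is_deriveZ e dgl)); rewrite /GRing.scale/=; ring.
by rewrite (step _ _ c df) (step _ _ (c * d) df') expr2 mulrA.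
Qed.

Lemma cCinf_dilation c gamma : cCinf (dilation c gamma).
Proof.
have [v1 v2] := vC; split=> n.
  under eq_fun do rewrite cReM /= mul0r subr0.
  by apply: CkZ; exact: (Ck_scale gamma^-1 (v1 n)).
under eq_fun do rewrite cImM /= mul0r addr0.
by apply: CkZ; exact: (Ck_scale gamma^-1 (v2 n)).
Qed.

Lemma dilation_supp c gamma x : 0 < gamma -> 2 * gamma < `|x| ->
  dilation c gamma x = 0.
Proof.
move=> g0 xg; rewrite /dilation v_supp ?mulr0//.
by rewrite normrM normfV (gtr0_norm g0) ltr_pdivlMr.
Qed.

Lemma cderive2_dilation c gamma x :
  cderive2 (dilation c gamma) x = (c * gamma^-1 ^+ 2)%:C * cderive2 v (x / gamma).
Proof.
have [v1 v2] := vC.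
have dE1 : (fun y => complex.Re (dilation c gamma y)) =
    (fun y => c * complex.Re (v (y * gamma^-1))).
  by apply/funext => y; rewrite cReM /= mul0r subr0.
have dE2 : (fun y => complex.Im (dilation c gamma y)) =
    (fun y => c * complex.Im (v (y * gamma^-1))).
  by apply/funext => y; rewrite cImM /= mul0r addr0.
rewrite /cderive2 dE1 dE2 (derive2_dilation c gamma^-1 x v1).
rewrite (derive2_dilation c gamma^-1 x v2).
set a := derive1 _ _; set b := derive1 _ _; set e := c * _.
by apply: eqRI; rewrite /= mul0r ?subr0 ?addr0.
Qed.

Lemma cderive2_supp s : 2 < `|s| -> cderive2 v s = 0.
Proof.
move=> s2; apply: eqRI; apply: derive1_supported s2 => x x2;
  apply: derive1_supported x2 => y y2; by rewrite v_supp.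
Qed.

Lemma profile_bounded : exists2 M, 0 <= M & forall s : R, `|s| <= 2 ->
  [/\ `|complex.Re (v s)| <= M, `|complex.Im (v s)| <= M,
      `|complex.Re (cderive2 v s)| <= M, `|complex.Im (cderive2 v s)| <= M
    & `|V1 m s| <= M].
Proof.
have [v1 v2] := vC.
have d2 (f : R -> R) : Cinf f -> continuous (derive1 (derive1 f)).
  by move=> fC; have [_ /CkS[_ [cf _]]] := CkS (fC 2%N).
have [M1 M10 h1] := continuous_bounded_interval 2 (Ck_continuous (v1 0%N)).
have [M2 M20 h2] := continuous_bounded_interval 2 (Ck_continuous (v2 0%N)).
have [M3 M30 h3] := continuous_bounded_interval 2 (d2 _ v1).
have [M4 M40 h4] := continuous_bounded_interval 2 (d2 _ v2).
have [M5 M50 h5] := continuous_bounded_interval 2 (@V1_continuous R m).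
have sum5 (a b c d e : R) : 0 <= a -> 0 <= b -> 0 <= c -> 0 <= d -> 0 <= e ->
    let M := a + b + c + d + e in
    [/\ a <= M, b <= M, c <= M, d <= M & e <= M] /\ 0 <= M.
  by move=> ? ? ? ? ? /=; split; [split|]; lra.
have [[le1 le2 le3 le4 le5] M_ge0] := sum5 _ _ _ _ _ M10 M20 M30 M40 M50.
exists (M1 + M2 + M3 + M4 + M5) => // s s2; split.
- exact: le_trans (h1 s s2) le1.
- exact: le_trans (h2 s s2) le2.
- exact: le_trans (h3 s s2) le3.
- exact: le_trans (h4 s s2) le4.
- exact: le_trans (h5 s s2) le5.
Qed.

(** The norm of the datum is bounded below by its values near the origin. *)
Lemma profile_nondegenerate : exists2 eta, 0 < eta & exists2 delta, 0 < delta &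
  forall s : R, `|s| <= eta -> delta <= abs2 (v s).
Proof.
have [v1 v2] := vC; pose delta := abs2 (v 0) / 2.
have av0 : 0 < abs2 (v 0) by exact: abs2_gt0.
have d0 : 0 < delta by rewrite divr_gt0.
have dv : delta < abs2 (v 0) by rewrite /delta; lra.
have ca : continuous (fun s => abs2 (v s)).
  by apply: (@Ck_continuous _ 0); apply: CkD; apply: CkX.
have : nbhs (0 : R) [set s | delta < abs2 (v s)].
  apply: open_nbhs_nbhs; split => //.
  apply: (@open_comp _ _ (fun s => abs2 (v s)) [set z | delta < z]).
    by move=> s _; exact: ca.
  exact: open_gt.
move=> /nbhs_ballP[e /= e0 he]; exists (e / 2); first by rewrite divr_gt0.
exists delta => // s se; apply: ltW; apply: he.
by rewrite /ball /= sub0r normrN; lra.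
Qed.

Lemma abs2_real_combination (a b d : R) (z w : R[i]) :
  abs2 (a%:C * z + b%:C * (d%:C * w)) =
  (a * complex.Re z + b * (d * complex.Re w)) ^+ 2
  + (a * complex.Im z + b * (d * complex.Im w)) ^+ 2.
Proof.
by case: z => z1 z2; case: w => w1 w2; rewrite /abs2 /= !mul0r !subr0 !addr0.
Qed.

Lemma dilation_residual_bound : exists2 K, 0 <= K &
  forall (c gamma : R) (k : int), 0 < c -> 0 < gamma -> gamma <= 1 ->
  k%:~R ^+ 2 * gamma ^+ (2 * m) = gamma ^- 2 ->
  forall x, `|x| <= 2 * gamma ->
  abs2 (profile_residual m k (dilation c gamma) x) <= 2 * (c * gamma ^- 2 * K) ^+ 2.
Proof.
have [M M0 vM] := profile_bounded.
pose K := M + (2 ^+ (2 * m) + M) * M.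
exists K => [|c gamma k c0 g0 g1 kg x xg].
  by rewrite addr_ge0// mulr_ge0// addr_ge0// exprn_ge0.
have gV : 1 <= gamma ^- 2 by rewrite invf_ge1 ?exprn_gt0// exprn_ile1// ltW.
have gV0 : 0 < gamma ^- 2 by exact: lt_le_trans gV.
set s := x / gamma.
have s2 : `|s| <= 2 by rewrite normrM normfV (gtr0_norm g0) ler_pdivrMr.
have x2 : `|x| <= 2 by apply: le_trans xg _; lra.
have [a1 a2 a3 a4 _] := vM s s2; have [_ _ _ _ a5] := vM x x2.
set q := k%:~R ^+ 2 * (1 - Afun m x ^- 2) - V1 m x.
have qM : `|q| <= gamma ^- 2 * (2 ^+ (2 * m) + M).
  have k20 : 0 <= k%:~R ^+ 2 :> R by exact: sqr_ge0.
  have h1 : `|k%:~R ^+ 2 * (1 - Afun m x ^- 2)| <= gamma ^- 2 * 2 ^+ (2 * m).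
    rewrite normrM (ger0_norm k20) distrC.
    apply: le_trans (ler_wpM2l k20 (AfunV2_near1 x m_gt0)) _.
    rewrite -kg -(mulrA _ (gamma ^+ _)) -exprMn; apply: (ler_wpM2l k20).
    rewrite -[X in X <= _]ger0_norm ?even_power_ge0// normrX mulrC.
    by rewrite lerXn2r// nnegrE// mulr_ge0// ltW.
  have h2 : M <= gamma ^- 2 * M by rewrite ler_peMl.
  apply: le_trans (ler_normB _ _) _.
  rewrite [X in _ <= X]mulrDr; apply: lerD => //.
  exact: le_trans a5 h2.
rewrite /profile_residual cderive2_dilation -/s -/q /dilation -/s.
have B (a b : R) : `|a| <= M -> `|b| <= M ->
    (c * gamma^-1 ^+ 2 * a + q * (c * b)) ^+ 2 <= (c * gamma ^- 2 * K) ^+ 2.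
  rewrite exprVn; move: (gamma ^- 2) gV0 qM => z z0 qM aM bM.
  have P0 : 0 <= 2 ^+ (2 * m) + M by rewrite addr_ge0// exprn_ge0.
  have K0 : 0 <= K by rewrite addr_ge0// mulr_ge0.
  rewrite -[X in X <= _]real_normK ?num_real//.
  rewrite lerXn2r ?nnegrE//; first by rewrite !mulr_ge0// ltW.
  apply: le_trans (ler_normD _ _) _; rewrite !normrM (gtr0_norm c0) (gtr0_norm z0).
  have -> : c * z * K = c * z * M + z * (2 ^+ (2 * m) + M) * (c * M).
    by rewrite /K; ring.
  apply: lerD; first by rewrite ler_wpM2l// mulr_ge0// ltW.
  apply: ler_pM => //; first by rewrite mulr_ge0// ltW.
  by rewrite ler_wpM2l// ltW.
rewrite abs2_real_combination.
by rewrite mulr_natl mulr2n; apply: lerD; apply: B.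
Qed.

(** The scale [gamma] is chosen so that [d^2/dx^2] and the potential both have
    size [gamma^-2] on the support of the datum. *)
Lemma residual_bound : exists2 C, 0 <= C &
  forall (c gamma : R) (k : int), 0 < c -> 0 < gamma -> gamma <= 1 ->
  k%:~R ^+ 2 * gamma ^+ (2 * m) = gamma ^- 2 ->
  nrm (residual m (wave k (dilation c gamma)) (k%:~R ^+ 2)) <=
  C * gamma ^- 2 * nrm (wave k (dilation c gamma)).
Proof.
have [K K0 hK] := dilation_residual_bound.
have [eta eta0 [delta delta0 hd]] := profile_nondegenerate.
pose C2 := 4 * K ^+ 2 / (delta * eta).
have C20 : 0 <= C2 by rewrite divr_ge0 ?mulr_ge0 ?sqr_ge0// ltW.
exists (Num.sqrt C2) => [|c gamma k c0 g0 g1 kg]; first exact: sqrtr_ge0.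
set phi := wave k (dilation c gamma).
have cphi : Cc_infty_cyl phi.
  apply: (@Cc_infty_cyl_wave _ (2 * gamma)); first exact: cCinf_dilation.
  by move=> x; exact: dilation_supp.
have sphi := Cc_infty_cyl_csqint cphi.
have sres : Csq (residual m phi (k%:~R ^+ 2)).
  have mFD := @measurable_FD R.
  exact: (csqintD mFD (lap_csqint m cphi) (csqintZ mFD _ sphi)).
have gV0 : 0 < gamma ^- 2 by rewrite invr_gt0 exprn_gt0.
have pi0 : 0 <= 2 * pi :> R := twopi_ge0.
have up : Crip (residual m phi (k%:~R ^+ 2)) (residual m phi (k%:~R ^+ 2)) <=
    2 * (c * gamma ^- 2 * K) ^+ 2 * (2 * (2 * gamma) * (2 * pi)).
  rewrite residual_wave in sres *; last exact: cCinf_dilation.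
  apply: rip_wave_le => //; first by rewrite mulr_ge0// ltW.
    exact: hK.
  move=> x xg; rewrite /profile_residual cderive2_dilation (dilation_supp _ g0 xg).
  by rewrite cderive2_supp ?mulr0 ?addr0// normrM normfV (gtr0_norm g0) ltr_pdivlMr.
have lo : c ^+ 2 * delta * (2 * (eta * gamma) * (2 * pi)) <= Crip phi phi.
  apply: rip_wave_ge => //; first by rewrite mulr_ge0// ltW.
  move=> x xg; rewrite /dilation abs2M.
  have -> : abs2 c%:C = c ^+ 2 by rewrite /abs2 /= expr0n addr0.
  rewrite ler_wpM2l ?sqr_ge0//; apply: hd.
  by rewrite normrM normfV (gtr0_norm g0) ler_pdivrMr.
have C2E : C2 * (delta * eta) = 4 * K ^+ 2.
  by rewrite /C2 divfK// mulf_neq0// gt_eqF.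
have h : Crip (residual m phi (k%:~R ^+ 2)) (residual m phi (k%:~R ^+ 2)) <=
    C2 * (gamma ^- 2) ^+ 2 * Crip phi phi.
  apply: le_trans up _; apply: le_trans (ler_wpM2l _ lo); last first.
    by rewrite mulr_ge0// sqr_ge0.
  have -> : C2 * (gamma ^- 2) ^+ 2 * (c ^+ 2 * delta * (2 * (eta * gamma) * (2 * pi))) =
      (C2 * (delta * eta)) * ((gamma ^- 2) ^+ 2 * c ^+ 2 * (2 * gamma * (2 * pi))).
    by move: (gamma ^- 2) (pi : R) => *; ring.
  (* [C2] was chosen to turn this comparison into an equality *)
  rewrite C2E le_eqVlt; apply/orP; left; apply/eqP.
  by move: (gamma ^- 2) (pi : R) => *; ring.
apply: le_trans (ler_wsqrtr h) _.
have sqrt3 (x y z : R) : 0 <= x -> 0 < y ->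
    Num.sqrt (x * y ^+ 2 * z) = Num.sqrt x * y * Num.sqrt z.
  move=> x0 y0; rewrite sqrtrM; last by rewrite mulr_ge0// sqr_ge0.
  by rewrite sqrtrM// sqrtr_sqr gtr0_norm.
by rewrite sqrt3.
Qed.

End ResidualBound.

(** * The lower bound *)
Section LowerBound.
Context {R : realType}.
Local Notation leb := (@lebesgue_measure R).
Local Notation cyl_measure := (leb \x leb)%E.
Local Notation FD := (@fundamental_domain R).
Local Notation Crip := (rip cyl_measure FD).
Local Notation Csq := (csqint cyl_measure FD).
Local Notation nrm f := (Num.sqrt (Crip f f)).

(** The integral of a nonnegative function is a supremum over its simple
    minorants, hence monotone for arbitrary functions; the squared norm of
    [<D_theta> chi psi] is an infimum over representatives at each time, so its
    measurability in time is not clear. *)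
Lemma integral_ge_cst d (T : measurableType d) (mu : {measure set T -> \bar R})
    (D : set T) (c : R) (F : T -> \bar R) : measurable D -> 0 <= c ->
  (forall x, D x -> (c%:E <= F x)%E) ->
  (c%:E * mu D <= \int[mu]_(x in D) F x)%E.
Proof.
move=> mD c0 cF; rewrite -integral_cst//.
have F0 x : D x -> (0 <= F x)%E by move=> Dx; apply: le_trans (cF x Dx); rewrite lee_fin.
rewrite integral_mkcond [leRHS]integral_mkcond.
rewrite !ge0_integralTE; last 2 first.
- exact: erestrict_ge0.
- by apply: erestrict_ge0 => x _; rewrite lee_fin.
apply: ereal_sup_le => _ [g gc <-]; exists g => // x.
apply: le_trans (gc x) _; rewrite !patchE.
by case: ifPn => // /set_mem; exact: cF.
Qed.

Lemma jap_ge (n : R) : `|n| <= jap n.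
Proof. by rewrite -sqrtr_sqr /jap ler_wsqrtr// lerDr. Qed.

Lemma wave_i k (U : R -> R[i]) :
  wave k (fun x => 'i * U x) = (fun p => 'i * wave k U p).
Proof. by apply/funext => p; rewrite /wave mulrCA. Qed.

(** Cauchy-Schwarz against the datum: only the mode [k] is tested, on which
    [<D_theta>] is the scalar [jap k]. *)
Lemma japD_sqnorm_correlation_ge k (U chi : R -> R[i]) (psi : R -> R * R -> R[i]) (kappa t : R) :
  let phi := wave k U in
  Cc_infty_cyl phi -> (forall x, U x != 0 -> chi x = 1) ->
  Csq (psi t) -> Crip phi phi / 2 <= correlation phi psi kappa t ->
  (((jap k%:~R) ^+ 2 * Crip phi phi / 16)%:E <=
   japD_sqnorm 1 (fun p => (chi p.1 * psi t p)%R))%E.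
Proof.
move=> phi cphi chi1 st; set N := Crip phi phi; set J := jap _ => Nc.
have mFD := @measurable_FD R.
have sphi : Csq phi := Cc_infty_cyl_csqint cphi.
have siphi : Csq (wave k (fun x => 'i * U x)) by rewrite wave_i; exact: csqintZ.
have N0 : 0 <= N := rip_ge0 _ _ _.
have J0 : 0 <= J by exact: sqrtr_ge0.
apply: le_ereal_inf_tmp => _ [g gD <-].
have [/L2_csqint sg _] := gD; rewrite sqnorm_rip// lee_fin.
have ga := japD_rip sphi st chi1 gD.
have gb : Crip g (wave k (fun x => 'i * U x)) =
    (jap k%:~R) `^ 1 * Crip (psi t) (wave k (fun x => 'i * U x)).
  apply: (japD_rip siphi st _ gD) => x iU; apply: chi1.
  by apply: contra iU => /eqP ->; rewrite mulr0.
rewrite (powRr1 J0) -/phi in ga.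
rewrite (powRr1 J0) (wave_i k U) -/phi in gb.
have CSa := rip_CS mFD sg sphi.
rewrite (wave_i k U) in siphi; have CSb := rip_CS mFD sg siphi.
rewrite ga -/N in CSa; rewrite gb rip_ii// -/N in CSb.
set a := Crip (psi t) phi in ga CSa *.
set b := Crip (psi t) _ in gb CSb *.
have corr : correlation phi psi kappa t <= `|a| + `|b|.
  have trig (c x : R) : `|c| <= 1 -> c * x <= `|x|.
    by move=> c1; rewrite (le_trans (ler_norm _))// normrM ler_piMl.
  by apply: lerD; apply: trig; [exact: cos_max|exact: sin_max].
rewrite normrM (ger0_norm J0) in CSa; rewrite normrM (ger0_norm J0) in CSb.
set G := Crip g g in CSa CSb *; have G0 : 0 <= G := rip_ge0 _ _ _.
have JN : J * N <= 4 * (Num.sqrt G * Num.sqrt N).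
  have : J * (N / 2) <= J * (`|a| + `|b|).
    by rewrite ler_wpM2l// (le_trans Nc).
  by lra.
have [N_eq0|N_neq0] := eqVneq N 0; first by rewrite N_eq0 mulr0 mul0r.
have Npos : 0 < N by rewrite lt_neqAle eq_sym N_neq0.
have sq : (J * N) ^+ 2 <= (4 * (Num.sqrt G * Num.sqrt N)) ^+ 2.
  by rewrite lerXn2r// nnegrE ?mulr_ge0 ?sqrtr_ge0.
rewrite !exprMn (sqr_sqrtr G0) (sqr_sqrtr N0) in sq.
have : N * (J ^+ 2 * N) <= N * (16 * G).
  have -> : N * (J ^+ 2 * N) = J ^+ 2 * N ^+ 2 by ring.
  by have -> : N * (16 * G) = 4 ^+ 2 * (G * N) by ring.
by rewrite ler_pM2l// ler_pdivrMr// mulrC (mulrC G).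
Qed.

(** Split [J ^ 2 = J ^ (2 r) J ^ q] and compare [J ^ q] with [n ^ q]. *)
Lemma jap_interpolation (n q r J : R) : 0 < n -> n <= J -> 0 <= q -> r * 2 + q = 2 ->
  (J `^ r) ^+ 2 <= J ^+ 2 * n `^ (- q).
Proof.
move=> n0 nJ q0 rq; have J0 : 0 < J by exact: lt_le_trans nJ.
have Jq0 : 0 < J `^ q by exact: powR_gt0.
have -> : (J `^ r) ^+ 2 = J ^+ 2 * (J `^ q)^-1.
  have -> : J ^+ 2 = J `^ (r * 2 + q) by rewrite rq powR_mulrn ?ltW.
  rewrite powRD; last by rewrite (gt_eqF J0) implybT.
  by rewrite powRrM powR_mulrn ?ltW ?powR_gt0// mulfK// gt_eqF.
rewrite powRN ler_wpM2l ?sqr_ge0// lef_pV2 ?posrE ?powR_gt0//.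
by rewrite ge0_ler_powR// nnegrE ltW.
Qed.

End LowerBound.

Theorem theorem3 (R : realType) (m : nat) (hm : (2 <= m)%N)
  (alpha beta : R) (halpha : 0 < alpha) (hbeta : 0 < beta)
  (chi0 : R -> R[i]) (hchi0 : Cc_infty chi0)
  (hchi0_1 : forall s : R, `|s| <= 1 -> chi0 s = 1)
  (hchi0_supp : supp chi0 `<=` `[-2, 2]) :
  exists (K0 : nat) (Astar : R),
  forall A0 : R, 0 < A0 -> Astar <= A0 ->
  exists C0 : R, 0 < C0 /\
  forall k : int, (K0 <= `|k|)%N ->
  let h : R := (`|k|%N%:R)^-1 in
  let utilde : R -> R[i] := quasi_utilde m alpha beta h chi0 in
  let phi0 : R * R -> R[i] :=
    fun p => cexp (0 +i* (k%:~R * p.2)) * utilde p.1 in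
  forall chi : R -> R[i], Cc_infty chi ->
  (forall x : R, supp utilde x -> chi x = 1) ->
  forall psi : R -> R * R -> R[i], schroedinger_solution m phi0 psi ->
  ((C0^-1)%:E * japD_sqnorm (m%:R / m.+1%:R) phi0 <=
   \int[lebesgue_measure]_(t in `[0%R, ((`|k|%N%:R) `^ (- (2 / m.+1%:R)) / A0)%R])
     japD_sqnorm 1 (fun p => (chi p.1 * psi t p)%R))%E.
Proof.
have m0 : (0 < m)%N by exact: leq_trans hm.
pose v := profile m alpha beta chi0.
have vC : cCinf v by exact: cCinf_profile.
have v_supp s : 2 < `|s| -> v s = 0 by exact: profile_supported.
have v0 : v 0 != 0 by apply: profile0_neq0 => //; rewrite hchi0_1// normr0.
have [C C_ge0 hC] := residual_bound m0 vC v_supp v0.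
(* [4 * C] keeps the relative loss [2 * C / A0] of the correlation at most one half *)
exists 1%N, (4 * C) => A0 A0_gt0 A0C; exists (16 * A0); split; first by rewrite mulr_gt0.
move=> k k1 h utilde phi0 chi _ chi1 psi sol.
pose n : R := `|k|%N%:R; have n1 : 1 <= n by rewrite ler1n.
have n0 : 0 < n by exact: lt_le_trans n1.
have h0 : 0 < h by rewrite invr_gt0.
pose gamma := h `^ (m.+1%:R^-1); have g0 : 0 < gamma by exact: powR_gt0.
pose c := (Num.sqrt (gamma ^+ m))^-1.
have c0 : 0 < c by rewrite invr_gt0 sqrtr_gt0 exprn_gt0.
have uE : utilde = dilation v c gamma.
  by apply/funext => x; exact: quasi_utilde_scaling.
have phiE : phi0 = wave k (dilation v c gamma) by rewrite -uE.
have gS : gamma ^+ m.+1 = h by exact: gamma_expS.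
have g1 : gamma <= 1.
  have : gamma ^+ m.+1 <= 1 by rewrite gS invf_le1.
  by rewrite expr_le1// ltW.
have kn : k%:~R ^+ 2 = n ^+ 2 :> R.
  by rewrite /n -[LHS]real_normK ?num_real// -intr_norm pmulrn -abszE.
(* the size of the potential [k ^ 2 x ^ (2 m)] at distance [gamma] *)
have kg : k%:~R ^+ 2 * gamma ^+ (2 * m) = gamma ^- 2.
  have -> : gamma ^- 2 = (n * gamma ^+ m.+1) ^+ 2 * gamma ^- 2.
    by rewrite gS mulfV ?gt_eqF// expr1n mul1r.
  rewrite kn exprMn -[RHS]mulrA; congr (_ * _).
  have -> : (gamma ^+ m.+1) ^+ 2 = gamma ^+ (2 * m) * gamma ^+ 2.
    by rewrite -exprM -exprD mulnC mulnS addnC.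
  by rewrite mulfK// expf_neq0// gt_eqF.
have gT : n `^ (- (2 / m.+1%:R)) = gamma ^+ 2.
  have -> : gamma ^+ 2 = gamma `^ 2 by rewrite powR_mulrn// ltW.
  have hE : h = n `^ (- 1) by rewrite powR_inv1// ltW.
  rewrite /gamma hE -!powRrM.
  by congr (_ `^ _); rewrite mulN1r ?mulNr (mulrC 2).
have cphi : Cc_infty_cyl phi0.
  rewrite phiE; apply: (@Cc_infty_cyl_wave _ (2 * gamma)).
    exact: cCinf_dilation.
  by move=> x; exact: dilation_supp.
pose N := rip (@lebesgue_measure R \x @lebesgue_measure R)%E
  (@fundamental_domain R) phi0 phi0.
have N0 : 0 <= N := rip_ge0 _ _ _.
pose J : R := jap k%:~R.
have nJ : n <= J.
  apply: le_trans (jap_ge _).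
  by have -> : `|k%:~R| = n by rewrite /n -intr_norm pmulrn -abszE.
set r := m%:R / m.+1%:R; set T := _ / A0.
have T0 : 0 <= T by rewrite /T gT mulr_ge0 ?exprn_ge0 ?invr_ge0 ?ltW.
have res : 2 * (Num.sqrt N * Num.sqrt (rip (@lebesgue_measure R \x @lebesgue_measure R)%E
    (@fundamental_domain R) (residual m phi0 (k%:~R ^+ 2))
    (residual m phi0 (k%:~R ^+ 2)))) * T <= N / 2.
  have := hC c gamma k c0 g0 g1 kg; rewrite -phiE -/N => /= hr.
  have hr' := ler_wpM2l (sqrtr_ge0 N) hr.
  have sN : Num.sqrt N * (C * gamma ^- 2 * Num.sqrt N) = C * gamma ^- 2 * N.
    rewrite -[X in _ = _ * X](sqr_sqrtr N0).
    by move: (Num.sqrt N) (gamma ^- 2) => *; ring.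
  rewrite sN in hr'.
  have hr2 := ler_wpM2r T0 (ler_wpM2l (ler0n R 2) hr').
  apply: le_trans hr2 _; rewrite /T gT.
  have -> : 2 * (C * gamma ^- 2 * N) * (gamma ^+ 2 / A0) = (2 * C * N) / A0.
    have : gamma ^+ 2 != 0 by rewrite expf_neq0// gt_eqF.
    by move: (gamma ^+ 2) => z z0; field; rewrite z0 gt_eqF.
  by rewrite ler_pdivrMr//; have := ler_wpM2r N0 A0C; lra.
have lower t : 0 <= t -> t <= T ->
    ((J ^+ 2 * N / 16)%:E <= japD_sqnorm 1 (fun p => (chi p.1 * psi t p)%R))%E.
  move=> t0 tT.
  have := correlation_lower_bound cphi sol (k%:~R ^+ 2) t0; rewrite -/N.
  set B := 2 * _ => hB.
  have B0 : 0 <= B by rewrite /B mulr_ge0// mulr_ge0// sqrtr_ge0.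
  have half : N / 2 <= correlation phi0 psi (k%:~R ^+ 2) t.
    by apply: le_trans hB; have := le_trans (ler_wpM2l B0 tT) res; lra.
  have st := psi_csqint sol t0.
  apply: (japD_sqnorm_correlation_ge (U := utilde) _ _ st half) => //.
  by move=> x ux; apply: chi1; apply: subset_closure.
apply: le_trans (_ : ((J ^+ 2 * N / 16)%:E * T%:E <= _)%E); last first.
  have muT : lebesgue_measure `[0, T]%classic = T%:E :> \bar R.
    rewrite lebesgue_measure_itv/= lte_fin; case: ltP => [_|T_le0].
      by rewrite sube0.
    by congr EFin; apply/eqP; rewrite eq_le T0 T_le0.
  rewrite -muT; apply: integral_ge_cst; first exact: measurable_itv.
    by rewrite divr_ge0// mulr_ge0// sqr_ge0.
  by move=> t; rewrite /= in_itv/= => /andP[t0 tT]; exact: lower.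
have sphi : csqint (@lebesgue_measure R \x @lebesgue_measure R)%E
  (@fundamental_domain R) (wave k utilde) := Cc_infty_cyl_csqint cphi.
have up := japD_sqnorm_wave_le r sphi.
apply: le_trans (lee_wpmul2l _ up) _.
  by rewrite lee_fin invr_ge0 mulr_ge0// ltW.
rewrite -/J -!EFinM lee_fin -/(wave k utilde) -/phi0 -/N.
have JT : (J `^ r) ^+ 2 <= J ^+ 2 * gamma ^+ 2.
  rewrite -gT; apply: jap_interpolation => //.
  have mS : m.+1%:R != 0 :> R by rewrite pnatr_eq0.
  by rewrite /r -addn1 natrD in mS *; field.
have -> : J ^+ 2 * N / 16 * T = (16 * A0)^-1 * (J ^+ 2 * gamma ^+ 2 * N).
  by rewrite /T gT; field; rewrite gt_eqF.
rewrite ler_wpM2l ?invr_ge0 ?mulr_ge0 ?(ltW A0_gt0)//.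
by rewrite ler_wpM2r.
Qed.
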